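(* Let $\mathcal{A}$ be a countable alphabet with at least two elements. Let $G,D$ be finite subsets of $\mathbb{Z}$ with $\min(G\cup D)=1$, and put $L_{D,G}:=\mathrm{diam}(G\cup D)$ and $K_{D,G}:=|G|+|D|$. Let $(X_j)_{j\in\mathbb{Z}}$ be a stationary $\mathcal{A}$-valued process with distribution $\mathbb{P}$ satisfying $\Gamma(\mathbb{P})>0$ and with margin $\delta_{D,G}$. Let $\epsilon>0$. If $$ n\geq \frac{4}{\left(\frac{\epsilon}{2}\vee\delta_{D,G}\right)^{2}}\left(\left(\frac{K_{D,G}}{\Gamma(\mathbb{P})}\right)^{2}\log\left(\frac{2\beta_{D,G}}{\epsilon}\right)+\frac{4K_{D,G}(1-\Gamma(\mathbb{P}))}{\Gamma(\mathbb{P})}+2\right)+L_{D,G}-2, $$ then the estimator $\hat f^n_{D,G}$ satisfies $$ R\big(\hat f^n_{D,G}\big)\leq \epsilon\wedge\beta_{D,G}. $$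
   Context: $\mathcal{A}$ is a countable set with the discrete topology and $\mathcal{A}^{\mathbb{Z}}$ carries the product topology. For finite $H\subset\mathbb{Z}$, $\mathrm{diam}(H):=\max H-\min H+1$; $X_H=(X_i)_{i\in H}$; $\theta^iH=H+i=\{i+j:j\in H\}$. $\mathbb{Z}_-=\{-1,-2,\dots\}$. $u\vee v=\max(u,v)$, $u\wedge v=\min(u,v)$. Left conditional expectations and $\Gamma$. For a stationary process $(X_i)_{i\in\mathbb{Z}}$ with distribution $\mathbb{P}$, $p:\mathcal{A}\times\mathcal{A}^{\mathbb{Z}_-}\to[0,1]$ denotes a regular version of the left conditional expectations, i.e. $\mathbb{E}(\mathbf{1}_{\{X_0=a\}}\mid\sigma(X_{-\infty}^{-1}))(x)=p(a|x)$ for $\mathbb{P}$-a.e. $x$. For $n\ge 0$, $$\mathrm{Var}_n(p):=\sup\Big\{\tfrac12\sum_{a\in\mathcal{A}}|p(a|x)-p(a|y)|: x,y\in\mathcal{A}^{\mathbb{Z}_-},\ x_i=y_i \text{ for } i\ge -n\Big\},$$ where for $n=0$ the supremum is over all pairs $x,y$. Set $\Gamma(\mathbb{P}):=\prod_{j=0}^\infty(1-\mathrm{Var}_j(p))$. Estimator. $D$ is the data set and $G$ the guess set. For a sample $X_1^n=(X_1,\dots,X_n)$, $b\in\mathcal{A}^D$, $a\in\mathcal{A}^G$, let $$N^n_{D,G}(b,a):=\sum_{i=0}^{n-1}\mathbf{1}\{X_{\theta^iD}=b,\ X_{\theta^iG}=a\},$$ where the indicator is zero by convention if $\theta^iD$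 or $\theta^iG$ is not included in $\{1,\dots,n\}$. The estimator is $\hat f^n_{D,G}(b):=\arg\max_{a\in\mathcal{A}^G}N^n_{D,G}(b,a)/n$ (a maximizer), a function of $X_1^n$ and $b$. Excess risk. Let $(X_j)_{j\in\mathbb{Z}}$ and $(Y_j)_{j\in\mathbb{Z}}$ be two independent copies of the process with distribution $\mathbb{P}$, with joint law $\widetilde{\mathbb{P}}=\mathbb{P}\otimes\mathbb{P}$; $\hat f^n_{D,G}$ is computed from $X_1^n$. Then $$R(\hat f^n_{D,G}):=\sup_{b\in\mathcal{A}^D}\Big(\widetilde{\mathbb{P}}\big(\hat f^n_{D,G}(Y_D)\neq Y_G\mid Y_D=b\big)-\inf_{a\in\mathcal{A}^G}\widetilde{\mathbb{P}}\big(a\neq Y_G\mid Y_D=b\big)\Big)\,\widetilde{\mathbb{P}}(Y_D=b),$$ the expression being $0$ when $\widetilde{\mathbb{P}}(Y_D=b)=0$. Margin. For $b\in\mathcal{A}^D$, $$\delta_{D,G}(b)=\inf\Big\{\mathbb{P}(X_G\neq c,X_D=b)-\inf_{a\in\mathcal{A}^G}\mathbb{P}(X_G\neq a,X_D=b)>0:\ c\in\mathcal{A}^G\Big\}$$ (the infimum of the strictly positive values), with $\delta_{D,G}(b)=0$ if the set is empty; the margin is $\delta_{D,G}:=\inf_{b\in\mathcal{A}^D}\delta_{D,G}(b)$. Also $$\beta_{D,G}:=\sup_{b\in\mathcal{A}^D}\Big\{\sup_{a\in\mathcal{A}^G}\mathbb{P}(Y_G=a,Y_D=b)-\inf_{c\in\mathcal{A}^G}\mathbb{P}(Y_G=c,Y_D=b)\Big\}.$$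 *)

(* Defs.v *)
From HB Require Import structures.
From mathcomp Require Import all_boot all_order all_algebra finmap.
From mathcomp Require Import all_classical all_reals all_analysis.

Set Implicit Arguments.
Unset Strict Implicit.
Unset Printing Implicit Defensive.

Import Order.TTheory GRing.Theory Num.Theory.
Import numFieldNormedType.Exports.

Local Open Scope classical_set_scope.
Local Open Scope ring_scope.

Section finite_subsets_of_Z.
Implicit Type H : {fset int}.

(* Junk value 0 on the empty set; [head 0 H] is an element of H otherwise. *)
Definition fset_min H : int := \big[Num.min/head 0 H]_(i <- H) i.
Definition fset_max H : int := \big[Num.max/head 0 H]_(i <- H) i.

Definition diam H : int := fset_max H - fset_min H + 1.

(* The translate H + i is included in {1, ..., n}. *)
Definition translate_in (n i : nat) H : bool :=
  [forall j : H, 1 <= val j + i%:Z <= n%:Z].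

End finite_subsets_of_Z.

Definition cylinders (I : Type) (A : pointedType) : set (set (I -> A)) :=
  [set C | exists (i : I) (a : A), C = [set x | x i = a]].

(* For I and A countable, <<s cylinders >> is the Borel sigma-algebra of the
   product of the discrete topologies. *)
Notation seqspace I A := (g_sigma_algebraType (@cylinders I A)).

Definition Zneg := {i : int | i < 0}.

Section process.
Variables (R : realType) (A : pointedType).
Implicit Types (P : probability (seqspace int A) R) (H D G : {fset int}).

Definition shift (k : int) (x : seqspace int A) : seqspace int A :=
  fun j => x (j + k).

Definition stationary P : Prop :=
  forall (k : int) (B : set (seqspace int A)), measurable B ->
    P (shift k @^-1` B) = P B.

Definition past (x : seqspace int A) : seqspace Zneg A := fun i => x (val i).

(* g is a version of E(f | S), S being a sub-sigma-algebra of that of T. *)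
Definition is_cond_expectation (d : measure_display) (T : measurableType d)
    (Q : probability T R) (S : set (set T)) (f g : T -> R) : Prop :=
  [/\ forall B : set R, measurable B -> S (g @^-1` B),
      Q.-integrable [set: T] (EFin \o g) &
      forall E, S E ->
        (\int[Q]_(x in E) (g x)%:E = \int[Q]_(x in E) (f x)%:E)%E].

Definition left_cond_expectations P (p : A -> seqspace Zneg A -> R) : Prop :=
  [/\ forall a x, 0 <= p a x,
      forall x, (\esum_(a in [set: A]) (p a x)%:E = 1)%E,
      forall a, measurable_fun [set: seqspace Zneg A] (p a) &
      forall a, is_cond_expectation P (g_sigma_algebra_preimage past)
                  \1_[set x | x 0 = a] (p a \o past)].

Definition total_variation (q r : A -> R) : \bar R :=
  ((2^-1)%:E * \esum_(a in [set: A]) (`|q a - r a|)%R%:E)%E.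

Definition Var (n : nat) (p : A -> seqspace Zneg A -> R) : R :=
  fine (ereal_sup [set v | exists x y : seqspace Zneg A,
    (forall i : Zneg, - n%:Z <= val i -> x i = y i) /\
    v = total_variation (p^~ x) (p^~ y)]).

(* The partial products are nonincreasing and nonnegative as soon as each
   p(. | x) is a probability, so that this is a genuine limit. *)
Definition Gamma (p : A -> seqspace Zneg A -> R) : R :=
  limn (fun n => \prod_(0 <= j < n) (1 - Var j p)).

(* x |-> x_H, an element of A^H *)
Definition restr H (x : seqspace int A) : {ffun H -> A} :=
  [ffun j => x (val j)].

Definition sample (n : nat) (x : seqspace int A) : n.-tuple A :=
  [tuple x (i.+1)%:Z | i < n].

(* X_{H + i}, read as an element of A^H, is restr H (shift i X). *)
Definition occurrences D G (n : nat) (x : seqspace int A)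
    (b : {ffun D -> A}) (a : {ffun G -> A}) : nat :=
  (\sum_(i < n) [&& translate_in n i D, translate_in n i G,
                    restr D (shift i%:Z x) == b
                  & restr G (shift i%:Z x) == a])%N.

Definition is_estimator D G (n : nat)
    (fhat : n.-tuple A -> {ffun D -> A} -> {ffun G -> A}) : Prop :=
  forall (x : seqspace int A) (b : {ffun D -> A}) (a : {ffun G -> A}),
    (occurrences n x b a)%:R / n%:R <=
    (occurrences n x b (fhat (sample n x) b))%:R / n%:R :> R.

(* Equal to 0 when F is Q-null, since 0^-1 = 0. *)
Definition cond_prob (T : Type) (Q : set T -> \bar R) (E F : set T) : R :=
  fine (Q (E `&` F)) / fine (Q F).

(* In a point z, z.1 is the process X and z.2 the independent copy Y. *)
Definition excess_risk P D G (n : nat)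
    (fhat : n.-tuple A -> {ffun D -> A} -> {ffun G -> A}) : R :=
  let PP := (P \x P)%E in
  sup (range (fun b : {ffun D -> A} =>
    let YD_b := [set z : seqspace int A * seqspace int A | restr D z.2 = b] in
    (cond_prob PP
       [set z | fhat (sample n z.1) (restr D z.2) <> restr G z.2] YD_b
     - inf (range (fun a : {ffun G -> A} =>
              cond_prob PP [set z | a <> restr G z.2] YD_b)))
    * fine (PP YD_b))).

(* By [inf0], this is 0 when no value is positive. *)
Definition margin_at P D G (b : {ffun D -> A}) : R :=
  let miss (c : {ffun G -> A}) :=
    fine (P [set x | restr G x <> c /\ restr D x = b]) in
  inf [set r | 0 < r /\ exists c, r = miss c - inf (range miss)].

Definition margin P D G : R :=
  inf (range (fun b : {ffun D -> A} => margin_at P G b)).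

Definition beta P D G : R :=
  sup (range (fun b : {ffun D -> A} =>
    let joint (a : {ffun G -> A}) :=
      fine (P [set y | restr G y = a /\ restr D y = b]) in
    sup (range joint) - inf (range joint))).

End process.

(* Main.v *)
Require Import Defs.
From mathcomp Require Import all_boot all_order all_algebra finmap.
From mathcomp Require Import all_classical all_reals all_analysis.
From mathcomp Require Import measurable_realfun ring lra zify.

Import Order.TTheory GRing.Theory Num.Theory.
Import numFieldNormedType.Exports.

Local Open Scope fset_scope.
Local Open Scope ring_scope.

(** Why the theorem holds.

    Fix a data word [b] and write [pi a] for P(X_G = a, X_D = b), [Z a] for the
    number of windows of the sample showing [b] and [a], minus its expectation
    [m * pi a], where [m] is the number of windows that fit in the sample. Let
    [a0] maximise [pi] ([joint_argmax]). Given the sample, the excess risk at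
    [b], multiplied by P(Y_D = b), is the gap [pi a0 - pi a] at the guess [a]
    ([excess_term_le]), so its expectation over the sample has to be bounded.
    The gap never exceeds beta ([joint_gap_le_beta]), and a nonzero gap is at
    least the margin ([margin_le_gap]). The guess [a] is at least as frequent as
    [a0], so that [m] times the gap is at most [M - Z a0], where [M] is the
    maximum of [Z] ([regret_le]).

    With q = K / Gamma, two facts on the fluctuations of [Z] suffice:
    the sum over [a] of the variances of the [Z a] is at most m q^2
    ([sum_mean_centered]), whence E M <= q sqrt m ([mean_max_centered]), and
    [M - Z a0] has Gaussian tails with variance proxy m q^2 around its mean
    ([mgf_centered]).

    Both come from the transfer operator T, which averages a function of the past
    over the next letter and preserves expectations by stationarity
    ([mean_transfer]). Let [f] vary by at most the sum of the costs [c i] of the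
    coordinates that change. Coupling the next letters of two pasts one at a time,
    the letters differ with probability at most Var_l when the pasts agree on
    their last [l] letters; hence T^k f varies with the last letter by at most
    [osc_bound k], the convolution of [c] with the renewal sequence of a house of
    cards chain ([iter_transfer_osc]), and that renewal sequence sums to at most
    1 / Gamma ([sum_renewal]). As T^k f tends to the constant E f, Hoeffding's
    lemma applied at each letter gives the Gaussian bound
    ([gaussian_concentration]), and the variances gained at each letter give the
    second moment bound ([sum_mean_sqr]). For window counts, a coordinate meets at
    most K windows and all costs add up to at most m K, whence the sum of the
    squares of [osc_bound] is at most m q^2 ([osc_sqr_sum]).

    If beta <= eps, the bound of the gap by beta suffices. Let eps < beta and
    lambda = ln (2 beta / eps). The hypothesis on
    [n] gives m t^2 >= 4 q^2 lambda, where t is the larger of eps / 2 and the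
    margin. If the margin is at most eps / 2, the expected gap is at most
    q / sqrt m <= eps ([mean_regime]). Otherwise the expected gap is at most beta
    times the probability that M - Z a0 >= m t, and the Gaussian tail bounds it by
    2 beta exp (- lambda) = eps ([tail_regime]). *)

Set Implicit Arguments.
Unset Strict Implicit.
Unset Printing Implicit Defensive.

Local Open Scope classical_set_scope.

(** * Sums against a summable weight on the naturals *)

Definition bounded_by (T : Type) (R : realType) (M : R) (f : T -> R) :=
  forall x, `|f x| <= M.

Definition bounded_real (T : Type) (R : realType) (f : T -> R) :=
  exists M, bounded_by M f.

Section weighted_sums.
Variable R : realType.
Implicit Types w f g : nat -> R.

(** The sums over the alphabet are transported to [nat], which carries the discrete
    sigma-algebra, so that the theory of the Lebesgue integral gives linearity and
    monotonicity for signed summands. *)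
Definition summing w := (forall k, 0 <= w k) /\
  (\sum_(k <oo) (w k)%:E < +oo)%E.

Definition wsum w f : R := \int[@counting nat R]_k (w k * f k).

Lemma wsum_integrable w f : summing w -> bounded_real f ->
  (@counting nat R).-integrable [set: nat] (EFin \o (fun k => w k * f k)).
Proof.
move=> [w0 wS] [M fM].
have wI : (@counting nat R).-integrable [set: nat] (EFin \o (fun k => M * w k)).
  have : (@counting nat R).-integrable [set: nat] (EFin \o w).
    apply/integrableP; split; first by [].
    rewrite ge0_integral_count//.
    by under eq_eseriesr do rewrite /= ger0_norm//.
  by move/(integrableZl measurableT M); apply: eq_integrable.
apply: le_integrable wI => //= k _.
rewrite lee_fin !normrM mulrC ler_wpM2r//.
exact: le_trans (fM k) (ler_norm _).
Qed.

Lemma bounded_real_cst (T : Type) (c : R) : bounded_real (fun _ : T => c).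
Proof. by exists `|c|. Qed.

Lemma bounded_realD (T : Type) (f g : T -> R) :
  bounded_real f -> bounded_real g -> bounded_real (fun x => f x + g x).
Proof.
move=> [M fM] [N gN]; exists (M + N) => x.
by rewrite (le_trans (ler_normD _ _))// lerD.
Qed.

Lemma bounded_realM (T : Type) (f g : T -> R) :
  bounded_real f -> bounded_real g -> bounded_real (fun x => f x * g x).
Proof.
move=> [M fM] [N gN]; exists (M * N) => x.
by rewrite normrM ler_pM.
Qed.

Lemma bounded_realN (T : Type) (f : T -> R) :
  bounded_real f -> bounded_real (fun x => - f x).
Proof. by move=> [M fM]; exists M => x; rewrite normrN. Qed.

Lemma bounded_realB (T : Type) (f g : T -> R) :
  bounded_real f -> bounded_real g -> bounded_real (fun x => f x - g x).
Proof. by move=> bf bg; apply: bounded_realD bf (bounded_realN bg). Qed.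

Lemma bounded_realZ (T : Type) (c : R) (f : T -> R) :
  bounded_real f -> bounded_real (fun x => c * f x).
Proof. exact/bounded_realM/bounded_real_cst. Qed.

Lemma bounded_real_sqr (T : Type) (f : T -> R) :
  bounded_real f -> bounded_real (fun x => f x ^+ 2).
Proof. by move=> bf; apply: bounded_realM. Qed.

Lemma bounded_real_sum (T I : Type) (s : seq I) (f : I -> T -> R) :
  (forall i, bounded_real (f i)) -> bounded_real (fun x => \sum_(i <- s) f i x).
Proof.
move=> bf; elim: s => [|i s [M IH]].
  by exists 0 => x; rewrite big_nil normr0.
have [N fN] := bf i; exists (N + M) => x.
by rewrite big_cons (le_trans (ler_normD _ _))// lerD.
Qed.

Lemma bounded_real_comp (S T : Type) (h : S -> T) (f : T -> R) :
  bounded_real f -> bounded_real (fun x => f (h x)).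
Proof. by move=> [M fM]; exists M => x. Qed.

Lemma bounded_real_expR (T : Type) (s : R) (f : T -> R) :
  bounded_real f -> bounded_real (fun x => expR (s * f x)).
Proof.
move=> [M fM]; exists (expR (`|s| * M)) => x.
rewrite ger0_norm ?expR_ge0// ler_expR (le_trans (ler_norm _))//.
by rewrite normrM ler_wpM2l.
Qed.

Lemma wsumD w f g : summing w -> bounded_real f -> bounded_real g ->
  wsum w (fun k => f k + g k) = wsum w f + wsum w g.
Proof.
move=> sw bf bg; rewrite /wsum -RintegralD//; try exact: wsum_integrable.
by apply: eq_Rintegral => k _; rewrite mulrDr.
Qed.

Lemma wsumZ w c f : summing w -> bounded_real f ->
  wsum w (fun k => c * f k) = c * wsum w f.
Proof.
move=> sw bf; rewrite /wsum -RintegralZl//; try exact: wsum_integrable.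
by apply: eq_Rintegral => k _; rewrite mulrCA.
Qed.

Lemma wsumN w f : summing w -> bounded_real f ->
  wsum w (fun k => - f k) = - wsum w f.
Proof.
move=> sw bf; rewrite -mulN1r -wsumZ//.
by apply: eq_Rintegral => k _; rewrite mulN1r.
Qed.

Lemma wsumB w f g : summing w -> bounded_real f -> bounded_real g ->
  wsum w (fun k => f k - g k) = wsum w f - wsum w g.
Proof.
by move=> sw bf bg; rewrite wsumD// ?wsumN//; exact: bounded_realN.
Qed.

Lemma wsum_sum (I : Type) (s : seq I) w (f : I -> nat -> R) : summing w ->
  (forall i, bounded_real (f i)) ->
  wsum w (fun k => \sum_(i <- s) f i k) = \sum_(i <- s) wsum w (f i).
Proof.
move=> sw bf; elim: s => [|i s IH].
  rewrite big_nil -[RHS](mul0r (wsum w (fun=> 1))) -wsumZ//.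
    by apply: eq_Rintegral => k _; rewrite big_nil mul0r.
  exact: bounded_real_cst.
rewrite big_cons -IH -wsumD//; last exact: bounded_real_sum.
by apply: eq_Rintegral => k _; rewrite big_cons.
Qed.

Lemma le_wsum w f g : summing w -> bounded_real f -> bounded_real g ->
  (forall k, f k <= g k) -> wsum w f <= wsum w g.
Proof.
move=> sw bf bg fg; apply: le_Rintegral => //; try exact: wsum_integrable.
by move=> k _; rewrite ler_wpM2l//; case: sw.
Qed.

Definition wmass w := wsum w (fun=> 1).

Lemma wsum_cst w c : summing w -> wsum w (fun=> c) = c * wmass w.
Proof.
move=> sw; rewrite -wsumZ//; last exact: bounded_real_cst.
by apply: eq_Rintegral => k _; rewrite mulr1.
Qed.

Lemma wmassE w : summing w -> ((wmass w)%:E = \sum_(k <oo) (w k)%:E)%E.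
Proof.
move=> sw; have [w0 wS] := sw.
rewrite /wmass /wsum /Rintegral.
under eq_integral do rewrite mulr1.
rewrite ge0_integral_count//.
rewrite fineK// ge0_fin_numE//; apply: nneseries_ge0 => k _ _.
by rewrite lee_fin.
Qed.

Lemma summing_le w w' : summing w' -> (forall k, 0 <= w k <= w' k) -> summing w.
Proof.
move=> [w'0 w'S] ww'; split=> [k|]; first by have /andP[] := ww' k.
apply: le_lt_trans w'S; apply: lee_nneseries => k _.
  by rewrite lee_fin; have /andP[] := ww' k.
by rewrite lee_fin; have /andP[] := ww' k.
Qed.

Lemma summing_add w w' : summing w -> summing w' -> summing (fun k => w k + w' k).
Proof.
move=> [w0 wS] [w'0 w'S]; split=> [k|]; first exact: addr_ge0.
under eq_eseriesr do rewrite EFinD.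
rewrite nneseriesD//; try by move=> k _ _; rewrite lee_fin.
exact: lte_add_pinfty.
Qed.

Lemma wsum_le_mass w f c : summing w -> bounded_real f ->
  (forall k, f k <= c) -> wsum w f <= c * wmass w.
Proof. by move=> sw bf fc; rewrite -wsum_cst// le_wsum//; exact: bounded_real_cst. Qed.

Lemma wsum_ge_mass w f c : summing w -> bounded_real f ->
  (forall k, c <= f k) -> c * wmass w <= wsum w f.
Proof. by move=> sw bf fc; rewrite -wsum_cst// le_wsum//; exact: bounded_real_cst. Qed.

Lemma wsum_addw w w' f : summing w -> summing w' -> bounded_real f ->
  wsum (fun k => w k + w' k) f = wsum w f + wsum w' f.
Proof.
move=> sw sw' bf; rewrite /wsum -RintegralD//; try exact: wsum_integrable.
by apply: eq_Rintegral => k _; rewrite mulrDl.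
Qed.

Definition distr w := summing w /\ wmass w = 1.

Lemma bounded_real_inf f : bounded_real f -> forall k, inf (range f) <= f k.
Proof.
move=> [M fM] k; apply: ge_inf; last by exists k.
by exists (- M) => _ [l _ <-]; have := fM l; rewrite ler_norml => /andP[].
Qed.

(** The common part [min w1 w2] is a coupling of [w1] and [w2] on the diagonal; it
    has mass one minus the total variation distance, and there the difference is
    at most [u]. On the remaining mass it is at most [z]. Keeping both bounds, and
    not only their sum, is what makes the product defining Gamma appear. *)
Lemma wsum_coupling w1 w2 f g u v z : distr w1 -> distr w2 ->
  bounded_real f -> bounded_real g -> u <= z ->
  (2^-1 * wsum (fun k => `|w1 k - w2 k|) (fun=> 1) <= v) ->
  (forall k, f k - g k <= u) -> (forall k l, f k - g l <= z) ->
  wsum w1 f - wsum w2 g <= (1 - v) * u + v * z.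
Proof.
move=> [s1 m1] [s2 m2] bf bg uz tv fgu fgz.
pose w := fun k => Num.min (w1 k) (w2 k).
pose d1 := fun k => w1 k - w k.
pose d2 := fun k => w2 k - w k.
have w0 k : 0 <= w k by rewrite le_min (proj1 s1) (proj1 s2).
have ww1 k : w k <= w1 k by rewrite ge_min lexx.
have ww2 k : w k <= w2 k by rewrite ge_min lexx orbT.
have sw : summing w by apply: (summing_le s1) => k; rewrite w0 ww1.
have sd1 : summing d1.
  apply: (summing_le s1) => k.
  by rewrite subr_ge0 ww1 gerBl w0.
have sd2 : summing d2.
  apply: (summing_le s2) => k.
  by rewrite subr_ge0 ww2 gerBl w0.
have split1 h : bounded_real h -> wsum w1 h = wsum w h + wsum d1 h.
  move=> bh; rewrite -wsum_addw//.
  by congr wsum; apply/funext => k; rewrite /d1 addrC subrK.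
have split2 h : bounded_real h -> wsum w2 h = wsum w h + wsum d2 h.
  move=> bh; rewrite -wsum_addw//.
  by congr wsum; apply/funext => k; rewrite /d2 addrC subrK.
have b1 : bounded_real (fun _ : nat => 1 : R) by exact: bounded_real_cst.
have := split1 _ b1; have := split2 _ b1; rewrite -!/(wmass _) m1 m2 => e2 e1.
have tvE : 2^-1 * wsum (fun k => `|w1 k - w2 k|) (fun=> 1) = wmass d1.
  have -> : (fun k => `|w1 k - w2 k|) = (fun k => d1 k + d2 k).
    apply/funext => k; rewrite /d1 /d2 /w.
    case: (leP (w1 k) (w2 k)) => w12.
      by rewrite ler0_norm ?subr_le0//; lra.
    by rewrite gtr0_norm ?subr_gt0//; lra.
  rewrite wsum_addw// -!/(wmass _); lra.
rewrite tvE in tv.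
rewrite split1// split2//.
set i := inf (range g).
have gi k : i <= g k by exact: bounded_real_inf.
have fi k : f k <= z + i.
  rewrite -lerBlDl; apply: lb_le_inf; first by exists (g 0%N), 0%N.
  by move=> _ [l _ <-]; rewrite lerBlDl -lerBlDr.
have W : wsum w f - wsum w g <= u * wmass w.
  by rewrite -wsumB// wsum_le_mass//; exact: bounded_realB.
have D1 : wsum d1 f <= (z + i) * wmass d1 by exact: wsum_le_mass.
have D2 : i * wmass d2 <= wsum d2 g by exact: wsum_ge_mass.
have e3 : wmass d2 = wmass d1 by lra.
rewrite e3 in D2.
have e4 : wmass w = 1 - wmass d1 by lra.
rewrite e4 in W.
have : (v - wmass d1) * (z - u) >= 0 by rewrite mulr_ge0// subr_ge0.
nra.
Qed.

End weighted_sums.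

(** * Hoeffding's lemma and sums of variances *)

Section hoeffding.
Variable R : realType.

Lemma ge0_of_derive_ge0 (f f' : R -> R) (x : R) :
  (forall y : R, is_derive y (1 : R) f (f' y)) -> (forall y, 0 <= y -> 0 <= f' y) ->
  0 <= f 0 -> 0 <= x -> 0 <= f x.
Proof.
move=> df f'0 f0 x0; apply: le_trans f0 _.
have dr y : derivable f y 1 by have [] := df y.
apply: (@ger0_derive1_ndecry R f 0) => //.
- move=> y; rewrite in_itv/= andbT => y0.
  by rewrite derive1E; have [_ ->] := df y; rewrite f'0// ltW.
- apply/continuous_subspaceT => y.
  exact/differentiable_continuous/derivable1_diffP.
Qed.

(** The logarithm of the ratio of both sides vanishes at 0 together with its
    derivative, and its second derivative is [1 / 4 - u * (1 - u) >= 0], where [u]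
    is the mean of the tilted Bernoulli law. *)
Lemma bernoulli_mgf_le (p h : R) : 0 <= p -> p < 1 -> 0 <= h ->
  1 - p + p * expR h <= expR (p * h + h ^+ 2 / 8).
Proof.
move=> p0 p1 h0.
pose Z (x : R) : R := 1 - p + p * expR x.
have Z0 x : 0 < Z x.
  by rewrite /Z ltr_wpDr ?subr_gt0// mulr_ge0// expR_ge0.
have dZ x : is_derive x (1:R) Z (p * expR x).
  by apply: is_derive_eq; rewrite /GRing.scale/=; ring.
pose u (x : R) : R := p * expR x * (Z x)^-1.
have du x : is_derive x (1:R) u (u x * (1 - u x)).
  have dV := is_deriveV (lt0r_neq0 (Z0 x)) (dZ x).
  apply: is_derive_eq; rewrite /u /GRing.scale/= ; have := Z0 x; move: (Z x) => z z0.
  by field; rewrite gt_eqF.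
pose g (x : R) : R := p + x / 4 - u x.
have dg x : is_derive x (1:R) g (1 / 4 - u x * (1 - u x)).
  by apply: is_derive_eq; rewrite /GRing.scale/=; ring.
have g_ge0 x : 0 <= x -> 0 <= g x.
  apply: (ge0_of_derive_ge0 dg) => [y _|].
    by rewrite (_ : _ - _ = (u y - 2^-1) ^+ 2) ?sqr_ge0//; field.
  rewrite /g /u /Z expR0 mulr1 subrK invr1; lra.
pose f (x : R) : R := p * x + x ^+ 2 / 8 - ln (Z x).
have df x : is_derive x (1:R) f (g x).
  have dl := is_derive1_ln (Z0 x).
  have dc := @is_derive1_comp R (@ln R) Z x _ _ dl (dZ x).
  rewrite [f](_ : _ = (p \*: @id R + 8^-1 \*: (@id R ^+ 2)) - (@ln R \o Z)); last first.
    apply/funext => y; rewrite /f /= !fctE /=.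
    have sc (a b : R) : a *: b = a * b by [].
    by rewrite !sc; field.
  apply: is_derive_eq; rewrite /g /u /GRing.scale/=.
  by field; rewrite gt_eqF.
have : 0 <= f h.
  apply: (ge0_of_derive_ge0 df) => //.
  by rewrite /f /Z expR0 mulr1 subrK ln1; lra.
by rewrite /f subr_ge0 -ler_expR lnK// posrE.
Qed.

(** Convexity: combine the tangent inequalities at [t * h] for the points 0 and
    [h]. *)
Lemma expR_chord (t h : R) : 0 <= t <= 1 -> expR (t * h) <= 1 - t + t * expR h.
Proof.
move=> /andP[t0 t1].
have tangent (x : R) : expR (t * h) * (1 + (x - t * h)) <= expR x.
  have -> : expR x = expR (t * h) * expR (x - t * h) by rewrite -expRD addrC subrK.
  by rewrite ler_pM2l ?expR_gt0// expR_ge1Dx.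
have := tangent 0; rewrite expR0 => T0; have T1 := tangent h.
set E := expR (t * h) in T0 T1 *.
have T0' : (1 - t) * (E * (1 + (0 - t * h))) <= (1 - t) * 1.
  by rewrite ler_wpM2l// subr_ge0.
have T1' : t * (E * (1 + (h - t * h))) <= t * expR h by rewrite ler_wpM2l.
nra.
Qed.

(** By convexity, the law on [[inf f, inf f + e]] with the given mean and the
    largest exponential moment is carried by the two end points; this is the
    Bernoulli case. *)
Lemma wsum_hoeffding (w f : nat -> R) (s e : R) : distr w -> bounded_real f ->
  0 <= s -> (forall k l, f k - f l <= e) ->
  wsum w (fun k => expR (s * f k)) <= expR (s * wsum w f + s ^+ 2 * e ^+ 2 / 8).
Proof.
move=> [sw mw] bf s0 osc.
set A := inf (range f).
have Af k : A <= f k by exact: bounded_real_inf.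
have fA k : f k <= A + e.
  rewrite -lerBlDr; apply: lb_le_inf; first by exists (f 0%N), 0%N.
  by move=> _ [l _ <-]; rewrite lerBlDl -lerBlDr.
have e0 : 0 <= e by have := osc 0%N 0%N; rewrite subrr.
have bA : bounded_real (fun k => f k - A).
  exact/bounded_realB/bounded_real_cst.
have wA : wsum w (fun k => f k - A) = wsum w f - A.
  by rewrite wsumB ?wsum_cst ?mw ?mulr1//; exact: bounded_real_cst.
have [e_eq0|e_neq0] := eqVneq e 0.
  have fE : f = fun=> A.
    by apply/funext => k; apply/le_anti; rewrite Af -[X in _ <= X]addr0 -e_eq0 fA.
  by rewrite fE !wsum_cst// mw !mulr1 e_eq0 expr0n/= mulr0 mul0r addr0.
have e_gt0 : 0 < e by rewrite lt_def e_neq0.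
pose t k := (f k - A) / e.
have t01 k : 0 <= t k <= 1.
  by rewrite divr_ge0 ?subr_ge0// ler_pdivrMr// mul1r lerBlDl fA.
have bt : bounded_real t.
  apply: (bounded_realM bA); exact: bounded_real_cst.
pose p := wsum w t.
have pE : p * e = wsum w f - A.
  rewrite -wA mulrC -wsumZ//; congr wsum; apply/funext => k.
  by rewrite /t mulrC divfK.
have p0 : 0 <= p.
  by rewrite -(mul0r (wmass w)); apply: wsum_ge_mass => // k; have /andP[] := t01 k.
have p1 : p <= 1.
  rewrite (le_trans (wsum_le_mass (c := 1) sw bt _)) ?mw ?mulr1// => k.
  by have /andP[] := t01 k.
have chord k : expR (s * f k) <= expR (s * A) * (1 - t k + t k * expR (s * e)).
  have -> : s * f k = s * A + t k * (s * e).
    by rewrite /t mulrCA divfK// mulrBr addrC subrK.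
  by rewrite expRD ler_pM2l ?expR_gt0//; exact: expR_chord.
have b2 : bounded_real (fun k => 1 - t k + t k * expR (s * e)).
  apply: bounded_realD.
    apply: bounded_realB => //; exact: bounded_real_cst.
  apply: bounded_realM => //; exact: bounded_real_cst.
have : wsum w (fun k => expR (s * f k)) <= expR (s * A) * (1 - p + p * expR (s * e)).
  have -> : expR (s * A) * (1 - p + p * expR (s * e)) =
      wsum w (fun k => expR (s * A) * (1 - t k + t k * expR (s * e))).
    rewrite wsumZ// wsumD//; last 2 first.
    - apply: bounded_realB => //; exact: bounded_real_cst.
    - apply: bounded_realM => //; exact: bounded_real_cst.
    rewrite wsumB//; last exact: bounded_real_cst.
    rewrite wsum_cst// mw mulr1 /p.
    rewrite [in RHS](_ : (fun k => t k * _) = fun k => expR (s * e) * t k).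
      by rewrite wsumZ// [X in _ + X]mulrC.
    by apply/funext => k; rewrite mulrC.
  apply: le_wsum => //; first exact: bounded_real_expR.
  exact: bounded_realZ.
move/le_trans; apply.
rewrite [leRHS](_ : _ =
    expR (s * A) * expR (p * (s * e) + (s * e) ^+ 2 / 8)); last first.
  rewrite -expRD; congr expR.
  have -> : p * (s * e) = s * (p * e) by ring.
  by rewrite pE; field.
rewrite ler_pM2l ?expR_gt0//.
have [->|pn1] := eqVneq p 1.
  rewrite subrr add0r !mul1r ler_expR lerDl divr_ge0// sqr_ge0//.
by apply: bernoulli_mgf_le; rewrite ?lt_neqAle ?pn1// mulr_ge0.
Qed.

(** Averaging the hypothesis over two independent points [k] and [l] gives twice
    the sum of the variances. The hypothesis bounds a squared distance between two
    values of a vector, which is sharper than the sum of the squared oscillations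
    of its coordinates. *)
Lemma wsum_variance (I : Type) (s : seq I) (w : nat -> R) (f : I -> nat -> R) (v : R) :
  distr w -> (forall i, bounded_real (f i)) ->
  (forall k l, \sum_(i <- s) (f i k - f i l) ^+ 2 <= v *+ 2) ->
  wsum w (fun k => \sum_(i <- s) (f i k) ^+ 2) <=
  \sum_(i <- s) (wsum w (f i)) ^+ 2 + v.
Proof.
move=> [sw mw] bf fv.
have b2 i : bounded_real (fun k => f i k ^+ 2) by exact: bounded_real_sqr.
pose q := \sum_(i <- s) wsum w (fun k => f i k ^+ 2).
pose m i := wsum w (f i).
have bs : bounded_real (fun k => \sum_(i <- s) (f i k) ^+ 2) by exact: bounded_real_sum.
have qE : wsum w (fun k => \sum_(i <- s) (f i k) ^+ 2) = q by rewrite wsum_sum.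
have bm : bounded_real (fun k => \sum_(i <- s) m i * f i k).
  by apply: bounded_real_sum => i; exact: bounded_realZ.
have H l : q - 2 * (\sum_(i <- s) m i * f i l) + \sum_(i <- s) (f i l) ^+ 2 <= v *+ 2.
  have bl : bounded_real (fun k => \sum_(i <- s) f i l * f i k).
    by apply: bounded_real_sum => i; exact: bounded_realZ.
  have -> : q - 2 * (\sum_(i <- s) m i * f i l) + \sum_(i <- s) (f i l) ^+ 2 =
     wsum w (fun k => \sum_(i <- s) (f i k - f i l) ^+ 2).
    transitivity (wsum w (fun k => \sum_(i <- s) (f i k) ^+ 2 -
        2 * (\sum_(i <- s) f i l * f i k) + \sum_(i <- s) (f i l) ^+ 2)).
      rewrite wsumD//; last 2 first.
      - by apply: bounded_realB => //; exact: bounded_realZ.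
      - exact: bounded_real_cst.
      rewrite wsum_cst// mw mulr1 wsumB//; last exact: bounded_realZ.
      rewrite wsumZ// qE wsum_sum//; last by move=> i; exact: bounded_realZ.
      congr (_ - 2 * _ + _); apply: eq_bigr => i _.
      by rewrite wsumZ// mulrC.
    congr wsum; apply/funext => k.
    rewrite mulr_sumr -sumrB -big_split/=; apply: eq_bigr => i _; ring.
  rewrite -[leRHS]mulr1 -[in leRHS]mw; apply: wsum_le_mass => //.
  apply: bounded_real_sum => i; apply: bounded_real_sqr.
  apply: bounded_realB => //; exact: bounded_real_cst.
have : wsum w (fun l =>
         q - 2 * (\sum_(i <- s) m i * f i l) + \sum_(i <- s) (f i l) ^+ 2)
     <= v *+ 2.
  rewrite -[leRHS]mulr1 -[in leRHS]mw; apply: wsum_le_mass => //.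
  apply: bounded_realD => //; apply: bounded_realB; first exact: bounded_real_cst.
  exact: bounded_realZ.
rewrite wsumD//; last first.
  by apply: bounded_realB; [exact: bounded_real_cst|exact: bounded_realZ].
rewrite wsumB//; [|exact: bounded_real_cst|exact: bounded_realZ].
rewrite wsum_cst// mw mulr1 wsumZ// !wsum_sum//; last by move=> i; exact: bounded_realZ.
rewrite -/q (eq_bigr (fun i => m i ^+ 2)); last first.
  by move=> i _; rewrite wsumZ// expr2.
rewrite mulr2n; lra.
Qed.

End hoeffding.

(** * The house of cards chain *)

Section house_of_cards.
Variables (R : realType) (v : nat -> R) (Gam : R).
Hypothesis v_ge0 : forall l, 0 <= v l.
Hypothesis v_lt1 : forall l, v l < 1.
Hypothesis v_nincr : forall l, v l.+1 <= v l.
Hypothesis Gam_gt0 : 0 < Gam.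
Hypothesis Gam_le : forall l, Gam <= \prod_(0 <= j < l) (1 - v j).

(** The chain goes from height [l] to [l.+1] with probability [1 - v l] and falls to
    0 with probability [v l]; [reset r l] is the probability that it falls at step
    [r.+1] when it starts at [l]. The height stands for the number of last letters
    on which two coupled pasts agree. *)
Fixpoint reset (r l : nat) : R :=
  if r is r'.+1 then (1 - v l) * reset r' l.+1 + v l * reset r' 0 else v l.

(** The probability of being at 0 at time [r], when the chain starts at 0. *)
Definition renewal (r : nat) : R := if r is r'.+1 then reset r' 0 else 1.

Lemma reset_ge0 r l : 0 <= reset r l.
Proof.
elim: r l => [|r IH] l //=.
by rewrite addr_ge0// mulr_ge0// subr_ge0 ltW.
Qed.

Lemma renewal_ge0 r : 0 <= renewal r.
Proof. by case: r => [|r] //=; exact: reset_ge0. Qed.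

(** A chain started lower stays lower under the monotone coupling, and falls with a
    larger probability. *)
Lemma reset_nincr r : nonincreasing_seq (reset r).
Proof.
elim: r => [|r IH]; apply/nonincreasing_seqP => l //=.
have v1 : 0 <= 1 - v l.+1 by rewrite subr_ge0 ltW.
have h1 := IH _ _ (leqnSn l.+1).
have h0 := IH _ _ (leq0n l.+1).
have hv := v_nincr l.
have : (1 - v l.+1) * (reset r l.+1 - reset r l.+2) >= 0 by rewrite mulr_ge0// subr_ge0.
have : (v l - v l.+1) * (reset r 0 - reset r l.+1) >= 0 by rewrite mulr_ge0// subr_ge0.
nra.
Qed.

(** Let [Gam] be the probability that the chain started at 0 never falls. It is
    then at 0 on average [1 / Gam] times, and started at [l] it ever falls with
    probability [1 - Gam / \prod_(j < l) (1 - v j)]. The right-hand side is the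
    product of these two quantities, and it satisfies the recursion exactly. *)
Lemma sum_reset n l :
  \sum_(r < n) reset r l <= Gam^-1 - (\prod_(0 <= j < l) (1 - v j))^-1.
Proof.
elim: n l => [|n IH] l.
  rewrite big_ord0 subr_ge0 lef_pV2 ?posrE//.
  exact: lt_le_trans (Gam_le l).
have G0 k : 0 < \prod_(0 <= j < k) (1 - v j) by exact: lt_le_trans (Gam_le k).
rewrite big_ord_recl/=.
rewrite big_split/= -!mulr_sumr.
have H1 : (1 - v l) * (\sum_(i < n) reset i l.+1) <=
    (1 - v l) * (Gam^-1 - (\prod_(0 <= j < l.+1) (1 - v j))^-1).
  by rewrite ler_wpM2l// subr_ge0 ltW.
have H2 : v l * (\sum_(i < n) reset i 0) <= v l * (Gam^-1 - 1).
  by rewrite ler_wpM2l// (le_trans (IH _))// big_geq// invr1.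
rewrite (le_trans (lerD (lexx _) (lerD H1 H2)))//.
rewrite big_nat_recr//= invfM !mulrBr mulrCA mulfV ?mulr1; last first.
  by rewrite subr_eq0 eq_sym lt_eqF.
lra.
Qed.

Lemma sum_renewal n : \sum_(r < n) renewal r <= Gam^-1.
Proof.
have GV : 1 <= Gam^-1.
  have := Gam_le 0; rewrite big_geq// => G1.
  by rewrite invf_ge1.
case: n => [|n]; first by rewrite big_ord0 (le_trans ler01).
rewrite big_ord_recl/=.
by have := sum_reset n 0; rewrite big_geq// invr1; lra.
Qed.

Variables (c : nat -> R) (kap C : R).
Hypothesis c_ge0 : forall i, 0 <= c i.
Hypothesis c_le : forall i, c i <= kap.
Hypothesis c_sum : forall n, \sum_(i < n) c i <= C.

(** The expected cost of the falls in the next [k] steps, a fall being charged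
    [c i] when [i] steps remain after it. *)
Definition future_cost (k l : nat) : R := \sum_(i < k) c i * reset (k - i.+1) l.

(** The same cost with a fall charged just before the first step: the price of
    changing one letter that is followed by [k] more letters. *)
Definition osc_bound (k : nat) : R := \sum_(i < k.+1) c i * renewal (k - i).

Lemma future_costS k l : future_cost k.+1 l =
  (1 - v l) * future_cost k l.+1 + v l * (c k + future_cost k 0).
Proof.
rewrite /future_cost big_ord_recr/= subnn/= mulrDr addrA addrAC.
congr (_ + _); last first.
  by rewrite mulrC.
rewrite !mulr_sumr -big_split/=; apply: eq_bigr => i _.
rewrite subSn// /=; ring.
Qed.

Lemma future_cost_nincr k l : future_cost k l <= future_cost k 0.
Proof. by apply: ler_sum => i _; rewrite ler_wpM2l// reset_nincr. Qed.

Lemma osc_boundE k : osc_bound k = c k + future_cost k 0.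
Proof.
rewrite /osc_bound big_ord_recr/= subnn mulr1 addrC; congr (_ + _).
by apply: eq_bigr => i _; rewrite -(subnSK (ltn_ord i)).
Qed.

Lemma osc_bound_ge0 k : 0 <= osc_bound k.
Proof. by apply: sumr_ge0 => i _; rewrite mulr_ge0// renewal_ge0. Qed.

Lemma future_cost_le k : future_cost k 0 <= osc_bound k.
Proof. by rewrite osc_boundE lerDr. Qed.

Lemma osc_bound_le k : osc_bound k <= kap / Gam.
Proof.
apply: (@le_trans _ _ (\sum_(i < k.+1) kap * renewal (k - i))).
  by apply: ler_sum => i _; rewrite ler_wpM2r// renewal_ge0.
rewrite -mulr_sumr ler_wpM2l//; first exact: le_trans (c_le 0).
rewrite (reindex_inj rev_ord_inj)/=.
under eq_bigr => i _ do rewrite subSS subKn -1?ltnS//.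
exact: sum_renewal.
Qed.

Lemma sum_osc_boundE n :
  \sum_(k < n) osc_bound k = \sum_(i < n) c i * \sum_(r < n - i) renewal r.
Proof.
elim: n => [|n IH]; first by rewrite !big_ord0.
rewrite big_ord_recr/= IH /osc_bound !big_ord_recr/= addrA; congr (_ + _).
  rewrite -big_split/=; apply: eq_bigr => i _.
  by rewrite subSn 1?ltnW// big_ord_recr/= mulrDr.
by rewrite subnn subSn// subnn big_ord_recr big_ord0/= add0r.
Qed.

Lemma sum_osc_bound n : \sum_(k < n) osc_bound k <= C / Gam.
Proof.
rewrite sum_osc_boundE (@le_trans _ _ ((\sum_(i < n) c i) / Gam))//.
  by rewrite mulr_suml; apply: ler_sum => i _; rewrite ler_wpM2l// sum_renewal.
by rewrite ler_wpM2r// invr_ge0 ltW.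
Qed.

(** Young's inequality for the convolution of [c] with the renewal sequence; the
    sup norm times the l1 norm bounds the squared l2 norm. *)
Lemma sum_osc_bound_sqr n : \sum_(k < n) osc_bound k ^+ 2 <= kap * C / Gam ^+ 2.
Proof.
apply: (@le_trans _ _ (kap / Gam * \sum_(k < n) osc_bound k)).
  rewrite mulr_sumr; apply: ler_sum => k _; rewrite expr2.
  by rewrite ler_wpM2r ?osc_bound_ge0// osc_bound_le.
rewrite (_ : kap * C / Gam ^+ 2 = kap / Gam * (C / Gam)); last first.
  by field; rewrite gt_eqF.
rewrite ler_wpM2l ?sum_osc_bound// divr_ge0// ?(ltW Gam_gt0)//.
exact: le_trans (c_le 0).
Qed.

(** The [osc_bound k] are summable. *)
Lemma osc_bound_small (eta : R) (n : nat) : 0 < eta ->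
  exists2 k, (n <= k)%N & osc_bound k <= eta.
Proof.
move=> eta0.
have [[k nk ke]|H] := pselect (exists2 k, (n <= k)%N & osc_bound k <= eta).
  by exists k.
exfalso.
have big k : (n <= k)%N -> eta < osc_bound k.
  by move=> nk; rewrite ltNge; apply/negP => ke; apply: H; exists k.
have sumM M : eta * M%:R <= \sum_(k < n + M) osc_bound k.
  elim: M => [|M IH].
    by rewrite mulr0; apply: sumr_ge0 => i _; exact: osc_bound_ge0.
  rewrite addnS big_ord_recr/= -natr1 mulrDr mulr1 lerD//.
  by rewrite ltW// big// leq_addr.
have C0 : 0 <= C / Gam.
  by rewrite (le_trans _ (sum_osc_bound 0))// big_ord0.
have := le_trans (sumM (Num.truncn (C / Gam / eta)).+1) (sum_osc_bound _).
rewrite -ler_pdivlMl// leNgt mulrC => /negP; apply.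
exact: truncnS_gt.
Qed.

End house_of_cards.

(** * Integrals against weights that agree on a sub-sigma-algebra *)

Section change_of_weight.
Context d d' (T : measurableType d) (S : measurableType d') (R : realType).
Variables (P : {measure set T -> \bar R}) (phi : T -> S).
Hypothesis mphi : measurable_fun [set: T] phi.

Import HBNNSimple.

Local Open Scope ereal_scope.

Lemma integral_simple_weight (f : T -> R) (h : {nnsfun S >-> R}) :
  (forall x, 0 <= f x)%R -> measurable_fun [set: T] f ->
  \int[P]_x (f x * h (phi x))%:E =
  \sum_(r \in range h) r%:E * \int[P]_(x in phi @^-1` (h @^-1` [set r])) (f x)%:E.
Proof.
move=> f0 mf.
have mB r : measurable (phi @^-1` (h @^-1` [set r])).
  by rewrite -[X in measurable X]setTI; exact: mphi.
have r0 (r : R) (x : T) : 0 <= (r * \1_(h @^-1` [set r]) (phi x))%:E * (f x)%:E.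
  by rewrite mule_ge0 ?lee_fin//; have := nnfun_muleindic_ge0 h r (phi x).
transitivity (\int[P]_x \sum_(r \in range h)
    ((r * \1_(h @^-1` [set r]) (phi x))%:E * (f x)%:E)).
  apply: eq_integral => x _.
  rewrite -ge0_mule_fsuml => [|r]; last exact: nnfun_muleindic_ge0.
  by rewrite fsumEFin// -(fimfunE _ (phi x)) -EFinM mulrC.
rewrite ge0_integral_fsum//; last first.
  move=> r; apply/measurable_EFinP; apply: measurable_funM => //.
  by apply: measurable_funM => //; exact: (measurable_indic (mB r)).
apply: eq_fsbigr => r; rewrite inE => -[y _ <-].
transitivity (\int[P]_x
  ((h y)%:E * ((\1_(phi @^-1` (h @^-1` [set h y])) x)%:E * (f x)%:E))).
  by apply: eq_integral => x _; rewrite EFinM muleA.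
rewrite ge0_integralZl//; last 3 first.
- apply/measurable_EFinP; apply: measurable_funM => //.
- by move=> x _; rewrite -EFinM lee_fin mulr_ge0.
- by rewrite lee_fin.
congr (_ * _).
rewrite [RHS]integral_mkcond; apply: eq_integral => x _.
by rewrite muleC epatch_indic.
Qed.

(** The hypothesis is the case where [g] is an indicator. For [f1] an indicator and
    [f2] its conditional expectation given [phi], this is the defining property of
    conditional expectations, extended from events to functions. *)
Lemma eq_integral_weight (f1 f2 : T -> R) (g : S -> R) :
  (forall x, 0 <= f1 x)%R -> measurable_fun [set: T] f1 ->
  (forall x, 0 <= f2 x)%R -> measurable_fun [set: T] f2 ->
  (forall E, measurable E ->
    \int[P]_(x in phi @^-1` E) (f1 x)%:E = \int[P]_(x in phi @^-1` E) (f2 x)%:E) ->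
  (forall y, 0 <= g y)%R -> measurable_fun [set: S] g ->
  \int[P]_x (f1 x * g (phi x))%:E = \int[P]_x (f2 x * g (phi x))%:E.
Proof.
move=> f10 mf1 f20 mf2 f12 g0 mg.
have mg' : measurable_fun [set: S] (EFin \o g) by exact/measurable_EFinP.
pose h := nnsfun_approx measurableT mg'.
have limE (f : T -> R) : (forall x, 0 <= f x)%R -> measurable_fun [set: T] f ->
    \int[P]_x (f x * g (phi x))%:E = limn (fun n => \int[P]_x (f x * h n (phi x))%:E).
  move=> f0 mf.
  rewrite -monotone_convergence//.
  - apply: eq_integral => x _; apply/esym/cvg_lim => //.
    under eq_fun do rewrite EFinM.
    rewrite EFinM; apply: cvgeZl => //.
    have g0' y : [set: S] y -> 0 <= (EFin \o g) y by rewrite lee_fin.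
    exact: (cvg_nnsfun_approx measurableT mg' g0' (x := phi x) I).
  - move=> n; apply/measurable_EFinP; apply: measurable_funM => //.
    exact: (measurableT_comp (measurable_funP (h n)) mphi).
  - by move=> n x _; rewrite lee_fin mulr_ge0.
  - move=> x _ m n mn; rewrite lee_fin ler_wpM2l//.
    exact/lefP/nd_nnsfun_approx.
rewrite !limE//; congr (limn _); apply/funext => n.
rewrite !integral_simple_weight//; apply: eq_fsbigr => r _; rewrite f12//.
Qed.

End change_of_weight.

(** * Measurability in spaces of sequences *)

Section sequence_spaces.
Variables (I : eqType) (A : pointedType).

Lemma measurable_cylinder (i : I) (a : A) :
  measurable [set x : seqspace I A | x i = a].
Proof. by apply: sub_sigma_algebra; exists i, a. Qed.

Lemma measurable_fun_seqspace d (T : measurableType d) (f : T -> seqspace I A) :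
  (forall i a, measurable [set x | f x i = a]) -> measurable_fun [set: T] f.
Proof.
move=> mf; apply: (@measurability d _ T (seqspace I A) setT f (@cylinders I A) erefl).
by move=> _ [_ [i [a ->]] <-]; rewrite setTI; exact: mf.
Qed.

(** Such a set is a countable union of cylinders, obtained by splitting along the
    values of one coordinate after the other. *)
Lemma measurable_finite_coords (s : seq I) (E : set (seqspace I A)) :
  countable [set: A] ->
  (forall x y, (forall i, i \in s -> x i = y i) -> E x -> E y) -> measurable E.
Proof.
move=> /countable_injP[code code_inj]; elim: s E => [|i s IH] E sE.
  have [[x Ex]|nE] := pselect (exists x, E x).
    rewrite (_ : E = setT) //; apply/seteqP; split=> // y _.
    exact: sE Ex.
  by rewrite (_ : E = set0)//; apply/seteqP; split=> // y Ey; apply: nE; exists y.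
pose dec k : A := get [set a | code a = k].
have codeK a : dec (code a) = a.
  apply: xget_unique => // b cb; apply: code_inj => //; exact: mem_setT.
pose upd (x : seqspace I A) (a : A) : seqspace I A := fun j => if j == i then a else x j.
rewrite (_ : E = \bigcup_k ([set x | x i = dec k] `&` [set x | E (upd x (dec k))])).
  apply: bigcup_measurable => k _; apply: measurableI; first exact: measurable_cylinder.
  apply: IH => x y xy; apply: sE => j; rewrite inE /upd.
  by case: eqVneq => //= _; exact: xy.
have updE (x : seqspace I A) : upd x (x i) = x.
  by apply/funext => j; rewrite /upd; case: eqVneq => [->|].
apply/seteqP; split=> [x Ex|x [k _ [/= <-]]]; last by rewrite updE.
by exists (code (x i)) => //=; rewrite codeK updE.
Qed.

Lemma measurable_fun_finite_coords (s : seq I) d (T : measurableType d)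
    (f : seqspace I A -> T) :
  countable [set: A] ->
  (forall x y, (forall i, i \in s -> x i = y i) -> f x = f y) ->
  measurable_fun [set: seqspace I A] f.
Proof.
move=> cA sf _ B mB; rewrite setTI.
by apply: (@measurable_finite_coords s) => // x y /sf xy; rewrite /preimage/= xy.
Qed.

End sequence_spaces.

(** * Pasts *)

Definition neg_index (k : nat) : Zneg := exist (fun i : int => i < 0) (Negz k) isT.

Lemma neg_indexP (i : Zneg) : exists k, i = neg_index k.
Proof. by case: i => -[//|k] i0; exists k; exact: val_inj. Qed.

Section pasts.
Variable A : pointedType.
Implicit Types x y : seqspace Zneg A.

(** The most recent letter of a past sits at index -1. *)
Definition snoc y (a : A) : seqspace Zneg A := fun i =>
  match val i with
  | Negz 0 => a
  | Negz k.+1 => y (neg_index k)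
  | Posz _ => point
  end.

Lemma past_shift1 (x : seqspace int A) :
  past (Defs.shift 1 x) = snoc (past x) (x 0).
Proof.
apply/funext => i; have [k ->] := neg_indexP i.
rewrite /past /Defs.shift /=; case: k => [|k] //=.
by congr (x _); rewrite [RHS]/= !NegzE; lia.
Qed.

Lemma measurable_past : measurable_fun [set: seqspace int A] (@past A).
Proof.
by apply: measurable_fun_seqspace => i a; exact: measurable_cylinder.
Qed.

Lemma measurable_shift k : measurable_fun [set: seqspace int A] (@Defs.shift A k).
Proof.
by apply: measurable_fun_seqspace => i a; exact: measurable_cylinder.
Qed.

Lemma measurable_snoc a : measurable_fun [set: seqspace Zneg A] (snoc ^~ a).
Proof.
apply: measurable_fun_seqspace => i b; have [[|k] ->] := neg_indexP i.
  rewrite /snoc/=; have [->|ab] := pselect (a = b).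
    by rewrite (_ : [set _ | _] = setT)//; apply/seteqP; split.
  by rewrite (_ : [set _ | _] = set0)//; apply/seteqP; split.
exact: measurable_cylinder.
Qed.

Definition agree (l : nat) x y :=
  forall i, (i < l)%N -> x (neg_index i) = y (neg_index i).

Lemma agree_snoc l x y a : agree l x y -> agree l.+1 (snoc x a) (snoc y a).
Proof. by move=> xy [|i] //= il; rewrite /snoc/= xy. Qed.

Lemma agree0 x y : agree 0 x y. Proof. by []. Qed.

End pasts.

(** * The left conditional expectations *)

Section kernel.
Variables (R : realType) (A : pointedType) (p : A -> seqspace Zneg A -> R).
Hypothesis p_ge0 : forall a x, 0 <= p a x.
Hypothesis p_sum : forall x, (\esum_(a in [set: A]) (p a x)%:E = 1)%E.
Hypothesis p_meas : forall a, measurable_fun [set: seqspace Zneg A] (p a).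
Variable code : A -> nat.
Hypothesis code_inj : injective code.

(** A default value outside the range of [code]; [weight] gives mass 0 to such
    indices. *)
Definition decode (k : nat) : A := get [set a | code a = k].

Lemma codeK : cancel code decode.
Proof. by move=> a; apply: xget_unique => // b /code_inj. Qed.

Lemma esum_decode (f : A -> \bar R) : (forall a, 0 <= f a)%E ->
  (\esum_(a in [set: A]) f a =
   \sum_(k <oo) if code (decode k) == k then f (decode k) else 0)%E.
Proof.
move=> f0.
rewrite (_ : [set: A] = [set decode k | k in [set k | code (decode k) == k]]); last first.
  apply/seteqP; split=> // a _; exists (code a) => /=; last exact: codeK.
  by rewrite codeK.
rewrite esum_set_image//; last first.
  move=> k l; rewrite !inE/= => /eqP kE /eqP lE kl.
  by rewrite -kE -lE kl.
rewrite eseries_mkcond; apply: eq_eseriesr => k _.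
by rewrite mem_setE.
Qed.

Definition weight (y : seqspace Zneg A) (k : nat) : R :=
  if code (decode k) == k then p (decode k) y else 0.

Lemma weight_ge0 y k : 0 <= weight y k.
Proof. by rewrite /weight; case: ifP. Qed.

Lemma sum_weight y : (\sum_(k <oo) (weight y k)%:E = 1)%E.
Proof.
rewrite -(p_sum y) esum_decode; last by move=> a; rewrite lee_fin.
by apply: eq_eseriesr => k _; rewrite /weight; case: ifP.
Qed.

Lemma weight_summing y : summing (weight y).
Proof. by split; [exact: weight_ge0|rewrite sum_weight ltry]. Qed.

Lemma weight_distr y : distr (weight y).
Proof.
split; first exact: weight_summing.
apply: EFin_inj; rewrite wmassE ?sum_weight//; exact: weight_summing.
Qed.

Lemma dist_weight_le x y k :
  0 <= `|weight x k - weight y k| <= weight x k + weight y k.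
Proof.
rewrite normr_ge0/= (le_trans (ler_normB _ _))//.
by rewrite !ger0_norm ?weight_ge0.
Qed.

Lemma summing_dist_weight x y : summing (fun k => `|weight x k - weight y k|).
Proof.
by apply: (summing_le (summing_add (weight_summing x) (weight_summing y))) => k;
  exact: dist_weight_le.
Qed.

Lemma total_variationE x y :
  Defs.total_variation (p^~ x) (p^~ y) =
  (2^-1 * wsum (fun k => `|weight x k - weight y k|) (fun=> 1))%:E.
Proof.
rewrite /Defs.total_variation EFinM; congr (_ * _)%E.
rewrite [in RHS]wmassE; last exact: summing_dist_weight.
rewrite esum_decode//.
by apply: eq_eseriesr => k _; rewrite /weight; case: ifP => // _; rewrite subrr normr0.
Qed.

Lemma total_variation_le1 x y : (0 <= Defs.total_variation (p^~ x) (p^~ y) <= 1)%E.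
Proof.
rewrite total_variationE !lee_fin; apply/andP; split.
  rewrite mulr_ge0// ?invr_ge0//; apply: Rintegral_ge0 => k _.
  by rewrite mulr1.
have sx := weight_summing x; have sy := weight_summing y.
rewrite ler_pdivrMl// mulr1.
have <- : wmass (fun k => weight x k + weight y k) = 2.
  rewrite /wmass wsum_addw//; last exact: bounded_real_cst.
  by rewrite -!/(wmass _) (proj2 (weight_distr x)) (proj2 (weight_distr y)).
rewrite -lee_fin -!/(wmass _) (wmassE (summing_dist_weight x y)).
rewrite (wmassE (summing_add sx sy)).
apply: lee_nneseries => k _; first by rewrite lee_fin.
by rewrite lee_fin; have /andP[] := dist_weight_le x y k.
Qed.

Definition var_set (l : nat) := [set v | exists x y : seqspace Zneg A,
    (forall i : Zneg, - l%:Z <= val i -> x i = y i) /\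
    v = Defs.total_variation (p^~ x) (p^~ y)].

Lemma agreeP l x y : agree l x y <->
  (forall i : Zneg, - l%:Z <= val i -> x i = y i :> A).
Proof.
split=> [xy i|xy i il].
  by have [k ->] := neg_indexP i; rewrite /= => kl; apply: xy; rewrite NegzE in kl; lia.
by apply: xy; rewrite /= NegzE; lia.
Qed.

Lemma sup_var_set l : (0 <= ereal_sup (var_set l) <= 1)%E.
Proof.
apply/andP; split.
  have /andP[h _] := total_variation_le1 point point.
  by apply: le_trans h _; apply: ereal_sup_ubound; exists point, point.
apply: ge_ereal_sup => _ [x [y [_ ->]]].
by have /andP[] := total_variation_le1 x y.
Qed.

Lemma Var_fin l : ereal_sup (var_set l) = (Var l p)%:E.
Proof.
have /andP[s0 s1] := sup_var_set l.
by rewrite /Var fineK// ge0_fin_numE// (le_lt_trans s1)// ltry.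
Qed.

Lemma Var_ge0 l : 0 <= Var l p.
Proof. by rewrite -lee_fin -Var_fin; have /andP[] := sup_var_set l. Qed.

Lemma Var_le1 l : Var l p <= 1.
Proof. by rewrite -lee_fin -Var_fin; have /andP[] := sup_var_set l. Qed.

Lemma Var_nincr l : Var l.+1 p <= Var l p.
Proof.
rewrite -lee_fin -!Var_fin; apply: le_ereal_sup => _ [x [y [xy ->]]].
exists x, y; split=> // i il; apply: xy; lia.
Qed.

Lemma tv_le_Var l x y : agree l x y ->
  2^-1 * wsum (fun k => `|weight x k - weight y k|) (fun=> 1) <= Var l p.
Proof.
move=> /agreeP xy; rewrite -lee_fin -Var_fin -total_variationE.
by apply: ereal_sup_ubound; exists x, y.
Qed.

Hypothesis Gamma_gt0 : 0 < Gamma p.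

(** The partial products decrease to their limit. *)
Lemma Gamma_le l : Gamma p <= \prod_(0 <= j < l) (1 - Var j p).
Proof.
have nincr : nonincreasing_seq (fun n => \prod_(0 <= j < n) (1 - Var j p)).
  apply/nonincreasing_seqP => n; rewrite big_nat_recr//= ler_piMr//.
    by apply: prodr_ge0 => j _; rewrite subr_ge0 Var_le1.
  by rewrite gerBl Var_ge0.
apply: nonincreasing_cvgn_ge => //; apply: nonincreasing_is_cvgn => //.
exists 0 => _ [n _ <-]; apply: prodr_ge0 => j _.
by rewrite subr_ge0 Var_le1.
Qed.

Lemma Var_lt1 l : Var l p < 1.
Proof.
have := lt_le_trans Gamma_gt0 (Gamma_le l.+1).
rewrite big_nat_recr//=; have [->|v1 _] := eqVneq (Var l p) 1.
  by rewrite subrr mulr0 ltxx.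
by rewrite lt_neqAle v1 Var_le1.
Qed.

End kernel.

(** * Bounded measurable functions *)

Section bounded_measurable.
Context d (T : measurableType d) (R : realType).
Implicit Types f g : T -> R.

Definition bmfun f := measurable_fun [set: T] f /\ bounded_real f.

Lemma bmfun_cst (c : R) : bmfun (fun _ : T => c).
Proof. by split; [exact: measurable_cst|exact: bounded_real_cst]. Qed.

Lemma bmfunD f g : bmfun f -> bmfun g -> bmfun (fun x => f x + g x).
Proof.
by move=> [mf bf] [mg bg]; split; [exact: measurable_funD|exact: bounded_realD].
Qed.

Lemma bmfunM f g : bmfun f -> bmfun g -> bmfun (fun x => f x * g x).
Proof.
by move=> [mf bf] [mg bg]; split; [exact: measurable_funM|exact: bounded_realM].
Qed.

Lemma bmfunZ (c : R) f : bmfun f -> bmfun (fun x => c * f x).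
Proof. exact/bmfunM/bmfun_cst. Qed.

Lemma bmfunB f g : bmfun f -> bmfun g -> bmfun (fun x => f x - g x).
Proof.
by move=> [mf bf] [mg bg]; split; [exact: measurable_funB|exact: bounded_realB].
Qed.

Lemma bmfun_sqr f : bmfun f -> bmfun (fun x => f x ^+ 2).
Proof. by move=> nf; apply: bmfunM. Qed.

Lemma bmfun_sum (I : Type) (s : seq I) (f : I -> T -> R) :
  (forall i, bmfun (f i)) -> bmfun (fun x => \sum_(i <- s) f i x).
Proof.
move=> nf; split; last by apply: bounded_real_sum => i; case: (nf i).
by apply: measurable_sum => i; case: (nf i).
Qed.

Lemma bmfun_expR (s : R) f : bmfun f -> bmfun (fun x => expR (s * f x)).
Proof.
move=> nf; split; last by apply: bounded_real_expR; case: nf.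
apply: measurableT_comp; first exact: measurable_expR.
by case: (bmfunZ s nf).
Qed.

Lemma bmfun_integrable (P : probability T R) f : bmfun f ->
  P.-integrable [set: T] (EFin \o f).
Proof.
move=> [mf [M fM]].
have : P.-integrable [set: T] (EFin \o cst M).
  exact: finite_measure_integrable_cst.
move=> cI; apply: le_integrable cI => //; first exact/measurable_EFinP.
by move=> x _ /=; rewrite lee_fin (le_trans (fM x))// ler_norm.
Qed.

Lemma bmfun_max (f g : T -> R) : bmfun f -> bmfun g ->
  bmfun (fun x => Num.max (f x) (g x)).
Proof.
move=> [mf [M fM]] [mg [N gN]]; split; first exact: measurable_maxr.
exists (M + N) => x; have := fM x; have := gN x.
by rewrite !ler_norml maxEle; case: ifP => _ /andP[? ?] /andP[? ?]; lra.
Qed.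

Lemma bmfun_bigmax (I : Type) (s : seq I) (f0 : T -> R) (f : I -> T -> R) :
  bmfun f0 -> (forall i, bmfun (f i)) ->
  bmfun (fun x => \big[Num.max/f0 x]_(i <- s) f i x).
Proof.
move=> n0 nf; elim: s => [|i s IH].
  by rewrite (_ : (fun x => _) = f0)//; apply/funext => x; rewrite big_nil.
rewrite (_ : (fun x => _) =
    fun x => Num.max (f i x) (\big[Num.max/f0 x]_(i <- s) f i x)).
  exact: bmfun_max.
by apply/funext => x; rewrite big_cons.
Qed.

Lemma eq_indicE (B : eqType) (f : T -> B) (b : B) (x : T) :
  (f x == b)%:R = \1_[set x | f x = b] x :> R.
Proof.
rewrite indicE; case: eqVneq => [fx|/eqP fx]; first by rewrite mem_set.
by rewrite memNset.
Qed.

Lemma bmfun_eq (B : eqType) (f : T -> B) (b : B) :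
  measurable [set x | f x = b] -> bmfun (fun x => (f x == b)%:R : R).
Proof.
move=> mf; split; last first.
  by exists 1 => x; case: eqP => _; rewrite ?normr1 ?normr0.
rewrite (_ : (fun x => _) = \1_[set x | f x = b]); first exact: measurable_indic.
by apply/funext => x; exact: eq_indicE.
Qed.

Lemma Rintegral_eq (P : probability T R) (B : eqType) (f : T -> B) (b : B) :
  measurable [set x | f x = b] ->
  \int[P]_x (f x == b)%:R = fine (P [set x | f x = b]).
Proof.
move=> mf; rewrite /Rintegral.
under eq_integral do rewrite eq_indicE.
by rewrite integral_indic// setIT.
Qed.

Lemma Rintegral_sum (P : probability T R) (I : Type) (s : seq I) (f : I -> T -> R) :
  (forall i, bmfun (f i)) ->
  \int[P]_x (\sum_(i <- s) f i x) = \sum_(i <- s) \int[P]_x f i x.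
Proof.
move=> nf; elim: s => [|i s IH].
  rewrite big_nil -[RHS](mul0r (fine (P [set: T]))) -Rintegral_cst//.
  by congr Rintegral; apply/funext => x; rewrite big_nil.
rewrite big_cons -IH -RintegralD//; last 2 first.
- exact: bmfun_integrable.
- by apply: bmfun_integrable; exact: bmfun_sum.
by congr Rintegral; apply/funext => x; rewrite big_cons.
Qed.

Lemma integral_prob_cst (P : probability T R) (r : R) : (\int[P]_x r%:E = r%:E)%E.
Proof.
rewrite integral_cst// [X in (_ * X)%E](_ : _ = 1%E) ?mule1//.
exact: (probability_setT P).
Qed.

Lemma Rintegral_prob_cst (P : probability T R) (r : R) : \int[P]_x r = r.
Proof. by rewrite /Rintegral integral_prob_cst. Qed.

End bounded_measurable.

Lemma bmfun_comp d d' (T : measurableType d) (S : measurableType d') (R : realType)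
    (h : T -> S) (f : S -> R) : measurable_fun [set: T] h -> bmfun f ->
  bmfun (fun x => f (h x)).
Proof.
by move=> mh [mf bf]; split; [exact: measurableT_comp mf mh|exact: bounded_real_comp].
Qed.

(** * The transfer operator *)

Section transfer.
Variables (R : realType) (A : pointedType) (p : A -> seqspace Zneg A -> R).
Hypothesis p_ge0 : forall a x, 0 <= p a x.
Hypothesis p_sum : forall x, (\esum_(a in [set: A]) (p a x)%:E = 1)%E.
Hypothesis p_meas : forall a, measurable_fun [set: seqspace Zneg A] (p a).
Variable code : A -> nat.
Hypothesis code_inj : injective code.

Local Notation wt := (weight p code).
Local Notation dec := (decode code).
Local Notation pastspace := (seqspace Zneg A).
Implicit Types (f g : pastspace -> R) (y : pastspace).

Definition transfer g y : R := wsum (wt y) (fun k => g (snoc y (dec k))).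

Let wd y : distr (wt y). Proof. exact: weight_distr. Qed.
Let ws y : summing (wt y). Proof. by case: (wd y). Qed.
Let bcomp f y : bounded_real f -> bounded_real (fun k => f (snoc y (dec k))).
Proof. exact: bounded_real_comp. Qed.

Lemma transfer_cst c : transfer (fun=> c) = fun=> c.
Proof.
by apply/funext => y; rewrite /transfer wsum_cst// (proj2 (wd y)) mulr1.
Qed.

Lemma le_transfer f g : bounded_real f -> bounded_real g ->
  (forall y, f y <= g y) -> forall y, transfer f y <= transfer g y.
Proof. by move=> bf bg fg y; apply: le_wsum => //; exact: bcomp. Qed.

Lemma transferD f g : bounded_real f -> bounded_real g ->
  transfer (fun y => f y + g y) = fun y => transfer f y + transfer g y.
Proof. by move=> bf bg; apply/funext => y; apply: wsumD => //; exact: bcomp. Qed.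

Lemma transferZ c f : bounded_real f ->
  transfer (fun y => c * f y) = fun y => c * transfer f y.
Proof. by move=> bf; apply/funext => y; apply: wsumZ => //; exact: bcomp. Qed.

Lemma transfer_sum (I : Type) (s : seq I) (f : I -> pastspace -> R) :
  (forall i, bounded_real (f i)) ->
  transfer (fun y => \sum_(i <- s) f i y) = fun y => \sum_(i <- s) transfer (f i) y.
Proof.
by move=> bf; apply/funext => y; apply: wsum_sum => // i; exact: bcomp.
Qed.

Lemma transfer_bounded f : bounded_real f -> bounded_real (transfer f).
Proof.
move=> bf; have [M fM] := bf; exists M => y; rewrite ler_norml; apply/andP; split.
  rewrite (_ : - M = transfer (fun=> - M) y); last by rewrite transfer_cst.
  apply: le_transfer => //; first exact: bounded_real_cst.
  by move=> x; have := fM x; rewrite ler_norml => /andP[].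
rewrite (_ : M = transfer (fun=> M) y); last by rewrite transfer_cst.
apply: le_transfer => //; first exact: bounded_real_cst.
by move=> x; have := fM x; rewrite ler_norml => /andP[].
Qed.

Lemma transfer_series f y : bounded_real f -> (forall y, 0 <= f y) ->
  ((transfer f y)%:E =
   \sum_(k <oo) (wt y k * f (snoc y (dec k)))%:E)%E.
Proof.
move=> bf f0.
rewrite /transfer /wsum /Rintegral fineK; last first.
  apply: integrable_fin_num => //; apply: wsum_integrable => //; exact: bcomp.
rewrite ge0_integral_count// => k.
by rewrite lee_fin mulr_ge0// weight_ge0.
Qed.

Lemma measurable_weight k : measurable_fun [set: pastspace] (fun y => wt y k).
Proof.
rewrite /weight; case: (_ == k); [exact: p_meas|exact: measurable_cst].
Qed.

Lemma transfer_bmfun f : bmfun f -> bmfun (transfer f).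
Proof.
suff H g : bmfun g -> (forall y, 0 <= g y) ->
    measurable_fun [set: pastspace] (transfer g).
  move=> nf; split; last by apply: transfer_bounded; case: nf.
  have [mf [M fM]] := nf.
  have -> : transfer f = fun y => transfer (fun y => f y + M) y + - M.
    apply/funext => y; rewrite transferD ?transfer_cst ?addrK//.
      by exists M.
    exact: bounded_real_cst.
  apply: measurable_funD => //; apply: H.
    by apply: bmfunD => //; exact: bmfun_cst.
  by move=> y /=; rewrite -lerBlDr sub0r; have := fM y; rewrite ler_norml => /andP[].
move=> [mg bg] g0; apply/measurable_EFinP.
rewrite (_ : _ \o _ = fun y =>
  (\sum_(k <oo | k \in xpredT) (wt y k * g (snoc y (dec k)))%:E)%E); last first.
  by apply/funext => y /=; rewrite transfer_series.
apply: (@ge0_emeasurable_sum _ _ R setT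
  (fun k y => (wt y k * g (snoc y (dec k)))%:E) xpredT).
  by move=> k y _ _; rewrite lee_fin mulr_ge0// weight_ge0.
move=> k _; apply/measurable_EFinP; apply: measurable_funM.
  exact: measurable_weight.
apply: measurableT_comp => //; exact: measurable_snoc.
Qed.

Lemma iter_transfer_bmfun k f : bmfun f -> bmfun (iter k transfer f).
Proof. by move=> nf; elim: k => //= k IH; exact: transfer_bmfun. Qed.

Lemma iter_transfer_sum k (I : Type) (s : seq I) (f : I -> pastspace -> R) :
  (forall i, bmfun (f i)) ->
  iter k transfer (fun y => \sum_(i <- s) f i y) =
  fun y => \sum_(i <- s) iter k transfer (f i) y.
Proof.
move=> nf; elim: k => //= k ->; rewrite transfer_sum// => i.
by case: (iter_transfer_bmfun k (nf i)).
Qed.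

Lemma iter_transferZ k c f : bmfun f ->
  iter k transfer (fun y => c * f y) = fun y => c * iter k transfer f y.
Proof.
move=> nf; elim: k => //= k ->; rewrite transferZ//.
by case: (iter_transfer_bmfun k nf).
Qed.

Variable P : probability (seqspace int A) R.
Hypothesis P_stationary : stationary P.
Hypothesis p_cond : forall a,
  is_cond_expectation P (g_sigma_algebra_preimage (@past A))
    \1_[set x | x 0 = a] (p a \o @past A).

Definition mean g : R := \int[P]_x g (past x).

Let ip f : bmfun f ->
  P.-integrable [set: seqspace int A] (EFin \o (fun x => f (past x))).
Proof.
move=> nf; apply: bmfun_integrable; apply: bmfun_comp => //.
exact: measurable_past.
Qed.

Lemma mean_cst c : mean (fun=> c) = c.
Proof. exact: Rintegral_prob_cst. Qed.

Lemma meanD f g : bmfun f -> bmfun g -> mean (fun y => f y + g y) = mean f + mean g.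
Proof. by move=> nf ng; apply: RintegralD => //; exact: ip. Qed.

Lemma meanB f g : bmfun f -> bmfun g -> mean (fun y => f y - g y) = mean f - mean g.
Proof. by move=> nf ng; apply: RintegralB => //; exact: ip. Qed.

Lemma meanZ c f : bmfun f -> mean (fun y => c * f y) = c * mean f.
Proof. by move=> nf; apply: RintegralZl => //; exact: ip. Qed.

Lemma le_mean f g : bmfun f -> bmfun g -> (forall y, f y <= g y) -> mean f <= mean g.
Proof. by move=> nf ng fg; apply: le_Rintegral => //; exact: ip. Qed.

Lemma mean_sum (I : Type) (s : seq I) (f : I -> pastspace -> R) :
  (forall i, bmfun (f i)) ->
  mean (fun y => \sum_(i <- s) f i y) = \sum_(i <- s) mean (f i).
Proof.
move=> nf; elim: s => [|i s IH].
  rewrite big_nil -[RHS](mean_cst 0); congr mean; apply/funext => y.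
  by rewrite big_nil.
rewrite big_cons -IH -meanD//; last exact: bmfun_sum.
by congr mean; apply/funext => y; rewrite big_cons.
Qed.

Lemma measurable_coord_eq a : measurable [set x : seqspace int A | x 0 = a].
Proof. exact: measurable_cylinder. Qed.

Lemma integral_conditioned a g :
  (forall y, 0 <= g y) -> measurable_fun [set: pastspace] g ->
  (\int[P]_x (p a (past x) * g (past x))%:E =
   \int[P]_x (\1_[set x | x 0 = a] x * g (past x))%:E)%E.
Proof.
move=> g0 mg.
apply: (@eq_integral_weight _ _ _ _ _ P (@past A) (@measurable_past A)
  (p a \o @past A) \1_[set x : seqspace int A | x 0 = a] g) => //.
- by move=> x; exact: p_ge0.
- exact: measurableT_comp (p_meas a) (@measurable_past A).
- exact: measurable_indic (measurable_coord_eq a).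
- move=> E mE; have [_ _ h] := p_cond a; apply: h.
  by exists E => //; rewrite setTI.
Qed.

Lemma integral_stationary k (g : seqspace int A -> R) : bmfun g ->
  (\int[P]_x (g (Defs.shift k x))%:E = \int[P]_x (g x)%:E)%E.
Proof.
move=> ng; have [mg _] := ng.
rewrite -[LHS](@integral_pushforward _ _ _ _ R (Defs.shift k) (@measurable_shift A k)
  P setT (fun x => (g x)%:E))//.
- apply: eq_measure_integral => [|mS B mB _]; first exact: measurable_shift.
  exact: P_stationary.
- exact/measurable_EFinP.
- apply: (@bmfun_integrable _ _ R P (fun x => g (Defs.shift k x))).
  by apply: bmfun_comp => //; exact: measurable_shift.
Qed.

(** By the conditional expectation property, integrating [transfer f] over the past
    amounts to integrating [f] over the past extended by the actual letter at 0,
    which is the past of the process shifted by one. *)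
Lemma mean_transfer f : bmfun f -> mean (transfer f) = mean f.
Proof.
suff H g : bmfun g -> (forall y, 0 <= g y) -> mean (transfer g) = mean g.
  move=> nf; have [mf [M fM]] := nf.
  have nM : bmfun (fun _ : pastspace => M) by exact: bmfun_cst.
  have nfM : bmfun (fun y => f y + M) by exact: bmfunD.
  apply: (addIr M).
  have := H _ nfM; rewrite meanD// mean_cst => <-.
    rewrite -[X in _ + X = _]mean_cst -meanD//; last exact: transfer_bmfun.
    rewrite transferD; [|by exists M|exact: bounded_real_cst].
    by congr mean; apply/funext => y; rewrite transfer_cst.
  by move=> y /=; rewrite -lerBlDr sub0r; have := fM y; rewrite ler_norml => /andP[].
move=> ng g0; have [mg bg] := ng.
rewrite /mean /Rintegral; congr fine.
rewrite -[RHS](@integral_stationary 1 (g \o @past A)); last first.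
  by apply: bmfun_comp => //; exact: measurable_past.
under eq_integral do rewrite transfer_series//.
have mk k : measurable_fun [set: seqspace int A]
    (fun x => (wt (past x) k * g (snoc (past x) (dec k)))).
  apply: measurable_funM.
    exact: measurableT_comp (measurable_weight k) (@measurable_past A).
  apply: measurableT_comp => //.
  exact: measurableT_comp (@measurable_snoc A (dec k)) (@measurable_past A).
rewrite integral_nneseries//; last 2 first.
- by move=> k; apply/measurable_EFinP.
- by move=> k x _; rewrite lee_fin mulr_ge0// weight_ge0.
transitivity (\sum_(k <oo) \int[P]_x
    ((code (x 0) == k)%:R * g (past (Defs.shift 1 x)))%:E)%E.
  apply: eq_eseriesr => k _; rewrite /weight; have [kE|kN] := eqVneq (code (dec k)) k.
    rewrite (integral_conditioned (dec k) (g := fun y => g (snoc y (dec k))))//.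
      apply: eq_integral => x _; rewrite indicE past_shift1.
      have [xk|xk] := eqVneq (x 0) (dec k).
        by rewrite mem_set// -xk/= xk kE eqxx.
      rewrite memNset; last by move=> /= /eqP; rewrite (negPf xk).
      case: eqVneq => [ck|_]; last by rewrite !mul0r.
      by move: xk; rewrite -ck codeK// eqxx.
    by apply: measurableT_comp => //; exact: measurable_snoc.
  under eq_integral do rewrite mul0r.
  rewrite integral0; apply/esym/integral0_eq => x _.
  case: eqVneq => [ck|_]; last by rewrite mul0r.
  by move: kN; rewrite -ck codeK// eqxx.
rewrite -integral_nneseries//; last 2 first.
- move=> k; apply/measurable_EFinP; apply: measurable_funM.
    apply: (@measurable_fun_finite_coords _ _ [:: 0]).
      by apply/countable_injP; exists code => a b _ _; exact: code_inj.
    by move=> x y /(_ 0 (mem_head _ _)) ->.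
  apply: measurableT_comp => //.
  exact: measurableT_comp (@measurable_past A) (@measurable_shift A 1).
- by move=> k x _; rewrite lee_fin mulr_ge0.
apply: eq_integral => x _.
rewrite (nneseriesD1 (n := code (x 0)))//=; last first.
  by move=> k _; rewrite lee_fin mulr_ge0.
rewrite eqxx mul1r eseries0 ?adde0// => k _ /=.
by rewrite eq_sym => /negPf ->; rewrite mul0r.
Qed.

Lemma mean_iter_transfer k f : bmfun f -> mean (iter k transfer f) = mean f.
Proof.
move=> nf; elim: k => //= k IH; rewrite mean_transfer//.
exact: iter_transfer_bmfun.
Qed.

End transfer.

(** * Concentration of Lipschitz functions of the past *)

Section concentration.
Variables (R : realType) (A : pointedType) (p : A -> seqspace Zneg A -> R).
Hypothesis p_ge0 : forall a x, 0 <= p a x.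
Hypothesis p_sum : forall x, (\esum_(a in [set: A]) (p a x)%:E = 1)%E.
Hypothesis p_meas : forall a, measurable_fun [set: seqspace Zneg A] (p a).
Variable code : A -> nat.
Hypothesis code_inj : injective code.
Variable P : probability (seqspace int A) R.
Hypothesis P_stationary : stationary P.
Hypothesis p_cond : forall a,
  is_cond_expectation P (g_sigma_algebra_preimage (@past A))
    \1_[set x | x 0 = a] (p a \o @past A).
Hypothesis Gamma_gt0 : 0 < Gamma p.

Local Notation wt := (weight p code).
Local Notation dec := (decode code).
Local Notation pastspace := (seqspace Zneg A).
Local Notation T := (transfer p code).
Local Notation E := (mean P).
Local Notation v := (fun l => Var l p).
Implicit Types (f g : pastspace -> R) (x y : pastspace).

Definition hamming_cost (c : nat -> R) (n : nat) x y : R :=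
  \sum_(i < n) c i * (x (neg_index i) != y (neg_index i))%:R.

Definition lipschitz_cost c n f := forall x y, f x - f y <= hamming_cost c n x y.

Let v_ge0 l : 0 <= v l. Proof. exact: (Var_ge0 p_ge0 p_sum code_inj). Qed.
Let v_lt1 l : v l < 1. Proof. exact: (Var_lt1 p_ge0 p_sum code_inj Gamma_gt0). Qed.
Let v_nincr l : v l.+1 <= v l. Proof. exact: (Var_nincr p_ge0 p_sum code_inj). Qed.
Let v_Gamma l : Gamma p <= \prod_(0 <= j < l) (1 - v j).
Proof. exact: (Gamma_le p_ge0 p_sum code_inj). Qed.

Let wd y : distr (wt y). Proof. exact: weight_distr. Qed.
Let ws y : summing (wt y). Proof. by case: (wd y). Qed.
Let Tbmfun k f : bmfun f -> bmfun (iter k T f). Proof. exact: iter_transfer_bmfun. Qed.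
Let Tbounded k f : bmfun f -> bounded_real (iter k T f).
Proof. by move=> nf; case: (Tbmfun k nf). Qed.
Let bcomp f y : bounded_real f -> bounded_real (fun k => f (snoc y (dec k))).
Proof. exact: bounded_real_comp. Qed.

Lemma hamming_cost_snoc c n k x y a b : (forall i, 0 <= c i) ->
  hamming_cost (fun i => c (i + k)%N) n (snoc x a) (snoc y b) <=
  c k * (a != b)%:R + hamming_cost (fun i => c (i + k.+1)%N) n x y.
Proof.
move=> c0; rewrite /hamming_cost; case: n => [|n].
  by rewrite !big_ord0 addr0 mulr_ge0.
rewrite big_ord_recl big_ord_recr/= add0n {1}/snoc/= lerD// {2}/snoc/=.
apply: ler_wpDr; first by rewrite mulr_ge0.
by apply: ler_sum => i _; rewrite /snoc/= addSnnS.
Qed.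

Variables (c : nat -> R) (n : nat).
Hypothesis c_ge0 : forall i, 0 <= c i.

(** Two pasts are continued by coupled letters. If the pasts agree on the last [l]
    letters, then with probability at least [1 - Var l] the new letters are equal,
    and the pasts agree on [l.+1] letters; otherwise the new disagreement costs
    [c k] and the agreement starts again from 0. The disagreements already present
    are charged by [hamming_cost]. *)
Lemma iter_transfer_lip f k l x y : bmfun f -> lipschitz_cost c n f -> agree l x y ->
  iter k T f x - iter k T f y <=
  hamming_cost (fun i => c (i + k)%N) n x y + future_cost v c k l.
Proof.
move=> nf lf; elim: k l x y => [|k IH] l x y xy.
  rewrite /future_cost big_ord0 addr0 (le_trans (lf _ _))//.
  by rewrite /hamming_cost; under [leRHS]eq_bigr do rewrite addn0.
rewrite [iter _ _ f]/= /transfer.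
set D := hamming_cost _ _ _ _.
have lk := future_cost_nincr v_lt1 v_nincr c_ge0 k l.+1.
have -> : D + future_cost v c k.+1 l =
    (1 - v l) * (D + future_cost v c k l.+1) + v l * (D + c k + future_cost v c k 0).
  by rewrite future_costS; ring.
apply: (@wsum_coupling _ (wt x) (wt y) (fun i => iter k T f (snoc x (dec i)))
   (fun i => iter k T f (snoc y (dec i)))) => //.
- exact/bcomp/Tbounded.
- exact/bcomp/Tbounded.
- by rewrite -addrA lerD2l (le_trans lk)// lerDr.
- exact: tv_le_Var.
- move=> i; apply: (le_trans (IH _ _ _ (agree_snoc (dec i) xy))).
  rewrite lerD2r (le_trans (hamming_cost_snoc _ _ _ _ _ _ _))//.
  by rewrite eqxx mulr0 add0r.
- move=> i j; apply: (le_trans (IH _ _ _ (agree0 _ _))).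
  rewrite lerD2r (le_trans (hamming_cost_snoc _ _ _ _ _ _ _))//.
  rewrite addrC lerD2l; case: eqP => _ //=; by rewrite ?mulr0 ?mulr1.
Qed.

Lemma iter_transfer_osc f k y a b : bmfun f -> lipschitz_cost c n f ->
  iter k T f (snoc y a) - iter k T f (snoc y b) <= osc_bound v c k.
Proof.
move=> nf lf; apply: (le_trans (iter_transfer_lip k nf lf (agree0 _ _))).
rewrite osc_boundE lerD2r (le_trans (hamming_cost_snoc _ _ _ _ _ _ _))//.
rewrite {1}/hamming_cost big1 ?addr0; first by case: eqP => _; rewrite ?mulr0 ?mulr1.
by move=> i _; rewrite eqxx mulr0.
Qed.

Hypothesis c_supp : forall i, (n <= i)%N -> c i = 0.

(** For [k >= n] only coupled letters enter [f], so that the values of [iter k T f] at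
    two pasts differ by at most [future_cost]; average over the second past. *)
Lemma iter_transfer_near_mean f k y : bmfun f -> lipschitz_cost c n f -> (n <= k)%N ->
  `|iter k T f y - E f| <= osc_bound v c k.
Proof.
move=> nf lf nk.
have osc x z : iter k T f x - iter k T f z <= osc_bound v c k.
  apply: (le_trans (iter_transfer_lip k nf lf (agree0 _ _))).
  rewrite {1}/hamming_cost big1 ?add0r ?future_cost_le// => i _.
  by rewrite c_supp ?mul0r// (leq_trans nk)// leq_addl.
have bm_k := Tbmfun k nf.
have <- : E (iter k T f) = E f by exact: mean_iter_transfer.
have bm_c r : bmfun (fun _ : pastspace => r : R) by exact: bmfun_cst.
have lo : E (iter k T f) <= iter k T f y + osc_bound v c k.
  rewrite -[leRHS](mean_cst P); apply: le_mean => // x.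
  by have := osc x y; lra.
have up : iter k T f y - osc_bound v c k <= E (iter k T f).
  rewrite -[leLHS](mean_cst P); apply: le_mean => // x.
  by have := osc y x; lra.
by rewrite ler_norml; apply/andP; split; lra.
Qed.

(** Hoeffding's lemma at each letter, the oscillation being [osc_bound]. *)
Lemma iter_transfer_expR f s k y : 0 <= s -> bmfun f -> lipschitz_cost c n f ->
  iter k T (fun x => expR (s * f x)) y <=
  expR (s * iter k T f y + s ^+ 2 * (\sum_(i < k) osc_bound v c i ^+ 2) / 8).
Proof.
move=> s0 nf lf; elim: k y => [|k IH] y.
  by rewrite big_ord0 mulr0 mul0r addr0.
rewrite [iter k.+1 _ _]/= [iter k.+1 T f]/=.
set C := s ^+ 2 * (\sum_(i < k) osc_bound v c i ^+ 2) / 8 in IH *.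
have nexp : bmfun (fun x => expR (s * iter k T f x)) by apply/bmfun_expR/Tbmfun.
apply: (@le_trans _ _ (expR C * T (fun x => expR (s * iter k T f x)) y)).
  rewrite -[leRHS]/((fun y => expR C * T _ y) y) -transferZ//; last by case: nexp.
  apply: le_transfer => //.
  - exact/Tbounded/bmfun_expR.
  - by apply: bounded_realZ; case: nexp.
  - by move=> x; rewrite -expRD addrC.
rewrite -[leRHS](_ : expR C *
  expR (s * T (iter k T f) y + s ^+ 2 * osc_bound v c k ^+ 2 / 8) = _); last first.
  by rewrite -expRD big_ord_recr/= /C; congr expR; ring.
rewrite ler_pM2l ?expR_gt0//.
apply: (wsum_hoeffding (wd y) (bcomp y (Tbounded k nf)) s0) => i j.
exact: iter_transfer_osc.
Qed.

Variables (C : R) (B : R).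
Hypothesis c_sum : forall m, \sum_(i < m) c i <= C.
Hypothesis osc_sqr_sum : forall m, \sum_(i < m) osc_bound v c i ^+ 2 <= B.

(** Integrate the pointwise bound and let the number of letters tend to infinity
    along a sequence on which [osc_bound] tends to 0. *)
Lemma gaussian_concentration f s : 0 <= s -> bmfun f -> lipschitz_cost c n f ->
  E (fun x => expR (s * f x)) <= expR (s * E f + s ^+ 2 * B / 8).
Proof.
move=> s0 nf lf; set a := s * E f + _.
have nexp : bmfun (fun x => expR (s * f x)) by exact: bmfun_expR.
have H eta : 0 < eta -> E (fun x => expR (s * f x)) <= expR (a + s * eta).
  move=> eta0.
  have [k nk ok] := osc_bound_small v_ge0 v_lt1 Gamma_gt0 v_Gamma c_ge0 c_sum n eta0.
  rewrite -(mean_iter_transfer p_ge0 p_sum p_meas code_inj P_stationary p_cond k nexp).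
  rewrite -(mean_cst P (expR _)); apply: le_mean => //.
  - exact: Tbmfun.
  - exact: bmfun_cst.
  move=> y; apply: (le_trans (iter_transfer_expR k y s0 nf lf)).
  rewrite ler_expR /a.
  have := iter_transfer_near_mean y nf lf nk; rewrite ler_norml => /andP[_ h1].
  have h2 : s * iter k T f y <= s * (E f + eta) by rewrite ler_wpM2l//; lra.
  have h3 : s ^+ 2 * (\sum_(i < k) osc_bound v c i ^+ 2) <= s ^+ 2 * B.
    by rewrite ler_wpM2l// sqr_ge0.
  lra.
have [->|s_neq0] := eqVneq (E (fun x => expR (s * f x))) 0; first exact: expR_ge0.
have Epos : 0 < E (fun x => expR (s * f x)).
  rewrite lt_def s_neq0/= -(mean_cst P 0); apply: le_mean => //; first exact: bmfun_cst.
rewrite -[leLHS]lnK ?posrE// ler_expR; apply/ler_addgt0Pr => e e0.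
have s1 : 0 < s + 1 by rewrite ltr_wpDl.
have e1 : 0 < e / (s + 1) by rewrite divr_gt0.
have := H _ e1; rewrite -[X in X <= _]lnK ?posrE// ler_expR => /le_trans; apply.
rewrite lerD2l mulrA ler_pdivrMr// mulrC ler_pM2l//; lra.
Qed.

Variables (I : Type) (r : seq I) (F : I -> pastspace -> R).
Hypothesis F_bmfun : forall i, bmfun (F i).
Hypothesis F_lip : forall i, lipschitz_cost c n (F i).
Hypothesis F_dual : forall u : I -> R, (forall i, `|u i| <= 2^-1) ->
  lipschitz_cost c n (fun y => \sum_(i <- r) u i * F i y).

(** Bounding each coordinate separately would cost a factor [size r]. The
    sum of the squares of the differences [d i] is the difference of the values
    of the single function with coefficients [d i], whose Lipschitz constant is
    controlled by the largest [d i], hence by [osc_bound] again. *)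
Lemma iter_transfer_osc_sqr k y a b :
  \sum_(i <- r) (iter k T (F i) (snoc y a) - iter k T (F i) (snoc y b)) ^+ 2 <=
  osc_bound v c k ^+ 2 *+ 2.
Proof.
set o := osc_bound v c k.
pose d i := iter k T (F i) (snoc y a) - iter k T (F i) (snoc y b).
have d_le i : `|d i| <= o.
  have := iter_transfer_osc k y a b (F_bmfun i) (F_lip i).
  have := iter_transfer_osc k y b a (F_bmfun i) (F_lip i).
  by rewrite -/o /d ler_norml => h1 h2; apply/andP; split; lra.
have : 0 <= o by exact: osc_bound_ge0.
rewrite le_eqVlt => /predU1P[z0|o_gt0].
  rewrite -z0 expr0n/= mul0rn big1// => i _.
  have := d_le i; rewrite -z0 normr_le0 /d => /eqP ->.
  by rewrite expr0n.
(* the normalisation required by F_dual; the case o = 0 has been dealt with *)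
pose u i := d i / (2 * o).
have u_le i : `|u i| <= 2^-1.
  rewrite normrM normfV (gtr0_norm (_ : 0 < 2 * o)) ?mulr_gt0//.
  by rewrite ler_pdivrMr ?mulr_gt0// mulrA mulVf ?mul1r.
have nZ i : bmfun (fun y => u i * F i y) by exact: bmfunZ.
have := iter_transfer_osc k y a b (bmfun_sum r nZ) (F_dual u_le).
rewrite iter_transfer_sum// -sumrB -/o.
under eq_bigr => i _ do rewrite iter_transferZ// -mulrBr -/(d i) /u mulrAC -expr2.
rewrite -mulr_suml ler_pdivrMr ?mulr_gt0// => /le_trans; apply.
by rewrite mulr2n; nra.
Qed.

Lemma iter_transfer_sum_sqr k y :
  iter k T (fun x => \sum_(i <- r) F i x ^+ 2) y <=
  \sum_(i <- r) iter k T (F i) y ^+ 2 + \sum_(j < k) osc_bound v c j ^+ 2.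
Proof.
elim: k y => [|k IH] y; first by rewrite big_ord0 addr0.
rewrite [iter k.+1 _ _]/=.
have nsq : bmfun (fun x => \sum_(i <- r) iter k T (F i) x ^+ 2).
  by apply: bmfun_sum => i; apply/bmfun_sqr/Tbmfun.
set S := \sum_(j < k) osc_bound v c j ^+ 2 in IH *.
apply: (@le_trans _ _ (T (fun x => \sum_(i <- r) iter k T (F i) x ^+ 2 + S) y)).
  apply: le_transfer => //.
  - by apply: Tbounded; apply: bmfun_sum => i; exact: bmfun_sqr.
  - by apply: bounded_realD; [case: nsq|exact: bounded_real_cst].
rewrite transferD//; [|by case: nsq|exact: bounded_real_cst].
rewrite transfer_cst// big_ord_recr/= [S + _]addrC addrA lerD2r.
apply: wsum_variance => // [i|j l].
  exact/bcomp/Tbounded.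
exact: iter_transfer_osc_sqr.
Qed.

(** Orthogonality of martingale increments, in the limit of a long past. *)
Lemma sum_mean_sqr :
  \sum_(i <- r) E (fun y => F i y ^+ 2) <= \sum_(i <- r) (E (F i)) ^+ 2 + B.
Proof.
apply/ler_addgt0Pr => e e0.
(* replacing T^k (F i) by its mean costs eta^2 for each i, and eta^2 <= eta <= e / M *)
pose M : R := (size r)%:R + 1.
have M0 : 0 < M by rewrite ltr_wpDl.
pose eta := Num.min 1 (e / M).
have eta0 : 0 < eta by rewrite lt_min ltr01 divr_gt0.
have [k nk ok] := osc_bound_small v_ge0 v_lt1 Gamma_gt0 v_Gamma c_ge0 c_sum n eta0.
have nsq i : bmfun (fun y => F i y ^+ 2) by exact: bmfun_sqr.
have nk2 i : bmfun (fun y => iter k T (F i) y ^+ 2) by exact/bmfun_sqr/Tbmfun.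
have near i : E (fun y => iter k T (F i) y ^+ 2) <= E (F i) ^+ 2 + eta ^+ 2.
  have nT := Tbmfun k (F_bmfun i).
  set m := E (F i).
  have mE : E (iter k T (F i)) = m by exact: mean_iter_transfer.
  have : E (fun y => iter k T (F i) y ^+ 2) <=
     E (fun y => 2 * m * iter k T (F i) y + (eta ^+ 2 - m ^+ 2)).
    apply: le_mean => //.
      by apply: bmfunD; [exact: bmfunZ|exact: bmfun_cst].
    move=> y; have := iter_transfer_near_mean y (F_bmfun i) (F_lip i) nk.
    rewrite -/m => h; have {}h := le_trans h ok.
    have : (iter k T (F i) y - m) ^+ 2 <= eta ^+ 2.
      by rewrite -real_normK ?num_real// ler_sqr ?nnegrE// ltW.
    nra.
  move/le_trans; apply; rewrite meanD//; [|exact: bmfunZ|exact: bmfun_cst].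
  rewrite meanZ// mean_cst mE; nra.
rewrite -mean_sum//.
rewrite -(mean_iter_transfer p_ge0 p_sum p_meas code_inj P_stationary p_cond k);
  last exact: bmfun_sum.
apply: (@le_trans _ _ (E (fun y => \sum_(i <- r) iter k T (F i) y ^+ 2 + B))).
  apply: le_mean.
  - by apply: Tbmfun; exact: bmfun_sum.
  - by apply: bmfunD; [exact: bmfun_sum|exact: bmfun_cst].
  - move=> y; rewrite (le_trans (iter_transfer_sum_sqr k y))// lerD2l.
    exact: osc_sqr_sum.
rewrite meanD//; [|exact: bmfun_sum|exact: bmfun_cst].
rewrite mean_cst mean_sum// addrAC lerD2r.
apply: (@le_trans _ _ (\sum_(i <- r) (E (F i) ^+ 2 + eta ^+ 2))).
  by apply: ler_sum => i _; exact: near.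
rewrite big_split/= lerD2l big_const_seq count_predT iter_addr addr0 -mulr_natl.
apply: (@le_trans _ _ (M * (e / M))); last by rewrite mulrC divfK ?gt_eqF.
rewrite ler_pM ?sqr_ge0//; first by rewrite /M lerDl.
have e1 : eta <= 1 by rewrite ge_min lexx.
have e2 : eta <= e / M by rewrite ge_min lexx orbT.
rewrite (le_trans _ e2)// expr2 ger_pMl//.
Qed.

End concentration.

(** * Windows in the sample *)

Definition sample_sites (n : nat) : seq int := [seq (Posz i.+1) | i <- iota 0 n].

Lemma mem_sample_sites (n : nat) (j : int) : (j \in sample_sites n) = (1 <= j <= n%:Z).
Proof.
apply/mapP/idP => [[i]|jn]; first by rewrite mem_iota => ni ->; lia.
by exists (absz j).-1; [rewrite mem_iota|]; lia.
Qed.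

Lemma eq_sample (A : pointedType) (n : nat) (x x' : seqspace int A) :
  (forall j, 1 <= j <= n%:Z -> x j = x' j) -> sample n x = sample n x'.
Proof.
by move=> xx'; apply: eq_mktuple => i; apply: xx'; have := ltn_ord i; lia.
Qed.

Lemma measurable_sample_event (A : pointedType) (V : Type) (n : nat)
    (g : seqspace int A -> V) (w : V) : countable [set: A] ->
  (forall x x', (forall j, 1 <= j <= n%:Z -> x j = x' j) -> g x = g x') ->
  measurable [set x | g x = w].
Proof.
move=> cA gx.
apply: (@measurable_finite_coords _ _ (sample_sites n)) => // x x' xx' /= <-.
by apply/esym/gx => j jn; apply: xx'; rewrite mem_sample_sites.
Qed.

Section window_counts.
Variables (R : realType) (A : pointedType) (D G : {fset int}) (n : nat).
Implicit Types (x : seqspace int A) (y : seqspace Zneg A).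

(** The sample occupies the [n] last coordinates of the past. *)
Definition unpast y : seqspace int A := fun j =>
  match j - n.+1%:Z with
  | Negz k => y (neg_index k)
  | Posz _ => point
  end.

Lemma unpastE y (j : int) (k : nat) : j = n%:Z - k%:Z -> unpast y j = y (neg_index k).
Proof.
move=> ->; rewrite /unpast.
have -> : n%:Z - k%:Z - n.+1%:Z = Negz k by rewrite NegzE; lia.
by [].
Qed.

Lemma unpast_past x (j : int) : j <= n%:Z ->
  unpast (past (Defs.shift n.+1%:Z x)) j = x j.
Proof.
move=> jn; have jE : j = n%:Z - (absz (n%:Z - j))%:Z by lia.
rewrite (unpastE _ jE) /past /Defs.shift; congr (x _).
by rewrite [val _]/= NegzE; lia.
Qed.

Lemma measurable_unpast : measurable_fun [set: seqspace Zneg A] unpast.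
Proof.
apply: measurable_fun_seqspace => j a; rewrite /unpast.
case: (j - n.+1%:Z) => k; last exact: measurable_cylinder.
have [->|pa] := pselect (point = a).
  by rewrite (_ : [set _ | _] = setT)//; apply/seteqP; split.
by rewrite (_ : [set _ | _] = set0)//; apply/seteqP; split.
Qed.

Definition valid (i : nat) : bool := translate_in n i D && translate_in n i G.

Definition sites : seq int := enum_fset D ++ enum_fset G.

Lemma valid_site i (j : int) : valid i -> j \in sites -> 1 <= j + i%:Z <= n%:Z.
Proof.
move=> /andP[/forallP vD /forallP vG]; rewrite mem_cat => /orP[jD|jG].
  exact: (vD [` jD]).
exact: (vG [` jG]).
Qed.

Lemma eq_restr_shift (H : {fset int}) x x' (i : int) :
  (forall j, j \in enum_fset H -> x (j + i) = x' (j + i)) ->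
  restr H (Defs.shift i x) = restr H (Defs.shift i x').
Proof.
move=> xx'; apply/ffunP => j; rewrite !ffunE /Defs.shift.
by apply: xx'; exact: valP.
Qed.

(** Counting with a general weight [u] covers the occurrences of a single word as
    well as the linear combinations used for the second moment bound. *)
Definition count_with (b : {ffun D -> A}) (u : {ffun G -> A} -> R) x : R :=
  \sum_(i < n | valid i)
    (restr D (Defs.shift i%:Z x) == b)%:R * u (restr G (Defs.shift i%:Z x)).

Lemma occurrencesE b a x :
  (occurrences n x b a)%:R = count_with b (fun a' => (a' == a)%:R) x :> R.
Proof.
rewrite /occurrences natr_sum /count_with [RHS]big_mkcond/=.
apply: eq_bigr => i _; rewrite /valid.
by case: translate_in; case: translate_in; case: (_ == b); case: (_ == a);
  rewrite /= ?mul0r ?mulr0 ?mulr1.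
Qed.

Lemma count_with_coords b u x x' :
  (forall j, 1 <= j <= n%:Z -> x j = x' j) -> count_with b u x = count_with b u x'.
Proof.
move=> xx'; apply: eq_bigr => i vi.
have e H : {subset enum_fset H <= sites} ->
    restr H (Defs.shift i%:Z x) = restr H (Defs.shift i%:Z x').
  by move=> Hs; apply: eq_restr_shift => j /Hs js; apply/xx'/valid_site.
by rewrite !e// => j js; rewrite mem_cat js ?orbT.
Qed.

(** The number of windows that see the coordinate [-(k+1)] of the past, that is the
    position [n - k] of the sample; a site in both [D] and [G] counts twice. *)
Definition site_cost (k : nat) : R :=
  \sum_(i < n | valid i) \sum_(j <- sites) (j + i%:Z == n%:Z - k%:Z)%:R.

Lemma site_cost_ge0 k : 0 <= site_cost k.
Proof. by apply: sumr_ge0 => i _; apply: sumr_ge0. Qed.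

Lemma site_cost_supp k : (n <= k)%N -> site_cost k = 0.
Proof.
move=> nk; rewrite /site_cost big1// => i vi; rewrite big1_seq// => j /andP[_ js].
have := valid_site vi js; case: eqP => // ->; lia.
Qed.

Lemma site_cost_le k : site_cost k <= (size sites)%:R.
Proof.
rewrite /site_cost exchange_big/= -sum1_size natr_sum; apply: ler_sum => j _.
have [i0 /andP[vi0 /eqP ji0]|no] :=
  pickP (fun i : 'I_n => valid i && (j + i%:Z == n%:Z - k%:Z)).
  rewrite (bigD1 i0)//= ji0 eqxx big1 ?addr0// => i /andP[_ ii0].
  case: eqP => // ji; case/eqP: ii0; apply: val_inj => /=; lia.
rewrite big1 ?ler01// => i vi; have := no i; rewrite vi /= => ->.
by [].
Qed.

Definition valid_count : nat := \sum_(i < n | valid i) 1.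

Lemma sum_site_cost m : \sum_(k < m) site_cost k <= valid_count%:R * (size sites)%:R.
Proof.
rewrite /site_cost exchange_big/= /valid_count natr_sum mulr_suml.
apply: ler_sum => i vi; rewrite mul1r exchange_big/= -sum1_size natr_sum.
apply: ler_sum => j _.
have [k0 /eqP jk0|no] := pickP (fun k : 'I_m => j + i%:Z == n%:Z - k%:Z).
  rewrite (bigD1 k0)//= jk0 eqxx big1 ?addr0// => k kk0.
  case: eqP => // jk; case/eqP: kk0; apply: val_inj => /=; lia.
by rewrite big1 ?ler01// => k _; rewrite no.
Qed.

(** Each window contributes a value in [[lo, lo + 1]] (0 included, for a wrong data
    word), and its contribution changes only if one of its sites does. *)
Lemma count_with_lip b u (lo : R) : lo <= 0 <= lo + 1 ->
  (forall a, lo <= u a <= lo + 1) ->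
  lipschitz_cost site_cost n (fun y => count_with b u (unpast y)).
Proof.
move=> lo01 ulo y y'.
have step i : valid i ->
   (restr D (Defs.shift i%:Z (unpast y)) == b)%:R *
     u (restr G (Defs.shift i%:Z (unpast y))) -
   (restr D (Defs.shift i%:Z (unpast y')) == b)%:R *
     u (restr G (Defs.shift i%:Z (unpast y')))
   <= \sum_(j <- sites) (unpast y (j + i%:Z) != unpast y' (j + i%:Z))%:R.
  move=> vi; have [/allP eq_s|/allPn[j js yj]] :=
      boolP (all (fun j => unpast y (j + i%:Z) == unpast y' (j + i%:Z)) sites).
    rewrite !(@eq_restr_shift _ (unpast y) (unpast y')).
    - by rewrite subrr; apply: sumr_ge0.
    - by move=> j jG; apply/eqP/eq_s; rewrite mem_cat jG orbT.
    - by move=> j jD; apply/eqP/eq_s; rewrite mem_cat jD.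
  apply: (@le_trans _ _ 1).
    have := ulo (restr G (Defs.shift i%:Z (unpast y))).
    have := ulo (restr G (Defs.shift i%:Z (unpast y'))).
    by case: (_ == b); case: (_ == b); rewrite /= ?mul1r ?mul0r; lra.
  rewrite (big_rem j)//= yj lerDl; exact: sumr_ge0.
rewrite /count_with -sumrB; apply: le_trans.
  by apply: ler_sum => i vi; exact: step.
rewrite /hamming_cost /site_cost.
under [leRHS]eq_bigr do rewrite mulr_suml.
rewrite [leRHS]exchange_big/=; apply: ler_sum => i vi.
under [leRHS]eq_bigr do rewrite mulr_suml.
rewrite [leRHS]exchange_big/=; rewrite big_seq [leRHS]big_seq; apply: ler_sum => j js.
have /andP[h1 h2] := valid_site vi js.
pose k := absz (n%:Z - (j + i%:Z))%R.
have kn : (k < n)%N by rewrite /k; lia.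
have jk : j + i%:Z = n%:Z - (Ordinal kn)%:Z by rewrite /= /k; lia.
rewrite (bigD1 (Ordinal kn))//= jk eqxx mul1r !(@unpastE _ _ (Ordinal kn))//.
rewrite lerDl; apply: sumr_ge0 => l _; exact: mulr_ge0.
Qed.

Lemma measurable_restr (H : {fset int}) (b : {ffun H -> A}) :
  countable [set: A] -> measurable [set x : seqspace int A | restr H x = b].
Proof.
move=> cA; apply: (@measurable_finite_coords _ _ (enum_fset H)) => // x x' xx' /= <-.
by apply/ffunP => j; rewrite !ffunE xx'//; exact: valP.
Qed.

End window_counts.

(** * The regret of an empirical maximiser *)

Section regret.
Variables (R : realType) (A : pointedType) (p : A -> seqspace Zneg A -> R).
Hypothesis p_ge0 : forall a x, 0 <= p a x.
Hypothesis p_sum : forall x, (\esum_(a in [set: A]) (p a x)%:E = 1)%E.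
Hypothesis p_meas : forall a, measurable_fun [set: seqspace Zneg A] (p a).
Variable code : A -> nat.
Hypothesis code_inj : injective code.
Variable P : probability (seqspace int A) R.
Hypothesis P_stationary : stationary P.
Hypothesis p_cond : forall a,
  is_cond_expectation P (g_sigma_algebra_preimage (@past A))
    \1_[set x | x 0 = a] (p a \o @past A).
Hypothesis Gamma_gt0 : 0 < Gamma p.

Variables (D G : {fset int}) (n : nat) (b : {ffun D -> A}).
Local Notation pastspace := (seqspace Zneg A).
Local Notation E := (mean P).
Local Notation v := (fun l => Var l p).
Local Notation unpast := (@unpast A n).
Local Notation m := ((valid_count D G n)%:R : R).
Local Notation K := ((size (sites D G))%:R : R).
Local Notation c := (@site_cost R D G n).
Implicit Types (x : seqspace int A) (y : pastspace) (a : {ffun G -> A}).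

Let cA : countable [set: A].
Proof. by apply/countable_injP; exists code => a a' _ _; exact: code_inj. Qed.

Definition joint a : R := fine (P [set x | restr G x = a /\ restr D x = b]).

(** By stationarity the last [n] letters of the past have the law of the sample. *)
Lemma mean_unpast (g : seqspace int A -> R) : bmfun g ->
  (forall x x', (forall j, j <= n%:Z -> x j = x' j) -> g x = g x') ->
  E (fun y => g (unpast y)) = \int[P]_x g x.
Proof.
move=> ng gx.
have np : bmfun (fun x => g (unpast (past x))).
  apply: (bmfun_comp (f := g \o unpast) (@measurable_past A)).
  exact: (bmfun_comp (@measurable_unpast A n) ng).
rewrite /mean /Rintegral -(integral_stationary P_stationary n.+1%:Z np).
congr fine; apply: eq_integral => x _; congr EFin.
by apply: gx => j jn; rewrite unpast_past.
Qed.

Definition point_indicator a : {ffun G -> A} -> R := fun a' => (a' == a)%:R.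

Definition hit a x : R := (restr D x == b)%:R * point_indicator a (restr G x).

Lemma bmfun_hit a : bmfun (hit a).
Proof. by apply: bmfunM; apply: bmfun_eq; exact: measurable_restr. Qed.

Lemma Rintegral_hit a : \int[P]_x hit a x = joint a.
Proof.
pose f x := (restr G x, restr D x).
have fE : [set x | f x = (a, b)] = [set x | restr G x = a /\ restr D x = b].
  by apply/seteqP; split=> x; rewrite /f/= => -[-> ->].
have mf : measurable [set x | f x = (a, b)].
  rewrite fE; apply: (@measurableI _ _ [set x | restr G x = a] [set x | restr D x = b]);
    exact: measurable_restr.
rewrite /joint -fE -(Rintegral_eq P mf); congr Rintegral; apply/funext => x.
by rewrite /hit /point_indicator -natrM mulnb xpair_eqE andbC.
Qed.

Lemma bmfun_hit_shift i a : bmfun (fun x => hit a (Defs.shift i x)).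
Proof. exact: (bmfun_comp (@measurable_shift A i) (bmfun_hit a)). Qed.

Lemma Rintegral_hit_shift i a : \int[P]_x hit a (Defs.shift i x) = joint a.
Proof.
by rewrite -Rintegral_hit /Rintegral (integral_stationary P_stationary i (bmfun_hit a)).
Qed.

Lemma count_withE a x : count_with n b (point_indicator a) x =
  \sum_(i <- [seq i <- index_iota 0 n | valid D G n i]) hit a (Defs.shift i%:Z x).
Proof. by rewrite big_filter big_mkord. Qed.

Lemma bmfun_count a : bmfun (count_with n b (point_indicator a)).
Proof.
rewrite (_ : count_with _ _ _ = fun x =>
  \sum_(i <- [seq i <- index_iota 0 n | valid D G n i]) hit a (Defs.shift i%:Z x)).
  by apply: bmfun_sum => i; exact: bmfun_hit_shift.
by apply/funext => x; exact: count_withE.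
Qed.

Lemma Rintegral_count a : \int[P]_x count_with n b (point_indicator a) x = m * joint a.
Proof.
under eq_Rintegral do rewrite count_withE.
rewrite Rintegral_sum => [|i]; last exact: bmfun_hit_shift.
rewrite big_filter big_mkord /valid_count natr_sum mulr_suml.
by apply: eq_bigr => i _; rewrite mul1r Rintegral_hit_shift.
Qed.

Definition centered_count a y : R :=
  count_with n b (point_indicator a) (unpast y) - m * joint a.

Lemma bmfun_centered a : bmfun (centered_count a).
Proof.
apply: bmfunB; last exact: bmfun_cst.
exact: (bmfun_comp (@measurable_unpast A n) (bmfun_count a)).
Qed.

Lemma mean_centered a : E (centered_count a) = 0.
Proof.
rewrite /centered_count meanB//; last exact: bmfun_cst.
  rewrite mean_cst mean_unpast; [|exact: bmfun_count|].
    by rewrite Rintegral_count subrr.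
  by move=> x x' xx'; apply: count_with_coords => j /andP[_ /xx'].
exact: (bmfun_comp (@measurable_unpast A n) (bmfun_count a)).
Qed.

Lemma centered_lip a : lipschitz_cost c n (centered_count a).
Proof.
move=> y y'; rewrite /centered_count opprB addrA subrK.
apply: (@count_with_lip R A D G n b (point_indicator a) 0).
  by rewrite lexx add0r ler01.
move=> a'; rewrite /point_indicator.
by case: eqP => _; rewrite /= ?lexx ?add0r ?lexx ?ler01.
Qed.

(** Such a combination is again a window count, with a weight of values in
    [[- 1 / 2, 1 / 2]]. *)
Lemma centered_dual (S : seq {ffun G -> A}) (u : {ffun G -> A} -> R) : uniq S ->
  (forall a, `|u a| <= 2^-1) ->
  lipschitz_cost c n (fun y => \sum_(a <- S) u a * centered_count a y).
Proof.
move=> uS u2.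
pose U a' := \sum_(a <- S) u a * point_indicator a a'.
have UE a' : U a' = if a' \in S then u a' else 0.
  rewrite /U; case: ifPn => a'S.
    rewrite (bigD1_seq a')//= /point_indicator eqxx mulr1 big1 ?addr0// => a aa'.
    by rewrite eq_sym (negPf aa') mulr0.
  rewrite big1_seq// => a /andP[_ aS]; rewrite /point_indicator.
  by case: eqP => [e|_]; rewrite ?mulr0//; move: a'S; rewrite e aS.
have sumE y : \sum_(a <- S) u a * centered_count a y =
    count_with n b U (unpast y) - \sum_(a <- S) u a * (m * joint a).
  under eq_bigr do rewrite mulrBr.
  rewrite sumrB; congr (_ - _).
  rewrite /count_with; under eq_bigr do rewrite mulr_sumr.
  rewrite exchange_big/=; apply: eq_bigr => i _; rewrite /U mulr_sumr.
  by apply: eq_bigr => a _; rewrite mulrCA.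
move=> y y'; rewrite !sumE opprB addrA subrK.
apply: (@count_with_lip R A D G n b U (- 2^-1)); first by apply/andP; split; lra.
move=> a; rewrite UE; have := u2 a; rewrite ler_norml => /andP[h1 h2].
by case: ifP => _; apply/andP; split; lra.
Qed.

Let c_ge0 := @site_cost_ge0 R D G n.
Let c_supp := @site_cost_supp R D G n.

Lemma osc_sqr_sum k : \sum_(i < k) osc_bound v c i ^+ 2 <= m * (K / Gamma p) ^+ 2.
Proof.
have v_ge0 l : 0 <= v l by exact: (Var_ge0 p_ge0 p_sum code_inj).
have v_lt1 l : v l < 1 by exact: (Var_lt1 p_ge0 p_sum code_inj Gamma_gt0).
have v_Gamma l : Gamma p <= \prod_(0 <= j < l) (1 - v j).
  exact: (Gamma_le p_ge0 p_sum code_inj).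
apply: le_trans.
  exact: (sum_osc_bound_sqr v_ge0 v_lt1 Gamma_gt0 v_Gamma c_ge0 (@site_cost_le R D G n)
    (@sum_site_cost R D G n)).
by rewrite le_eqVlt; apply/orP; left; apply/eqP; field; rewrite gt_eqF.
Qed.

Variables (S : seq {ffun G -> A}) (a0 : {ffun G -> A}).
Hypothesis (uS : uniq S) (a0S : a0 \in S).
Local Notation B := (m * (K / Gamma p) ^+ 2).

Definition max_centered y : R :=
  \big[Num.max/centered_count a0 y]_(a <- S) centered_count a y.

Lemma bmfun_max_centered : bmfun max_centered.
Proof. by apply: bmfun_bigmax => [|a]; exact: bmfun_centered. Qed.

Lemma le_max_centered a y : a \in S -> centered_count a y <= max_centered y.
Proof.
move=> aS; rewrite /max_centered.
exact: (le_bigmax_seq _ a xpredT (centered_count ^~ y) aS).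
Qed.

Lemma max_centered_lip : lipschitz_cost c n max_centered.
Proof.
move=> y y'; rewrite lerBlDl {1}/max_centered big_seq.
have H a : a \in S -> centered_count a y <= max_centered y' + hamming_cost c n y y'.
  move=> aS; have h1 := centered_lip a y y'.
  have h2 : centered_count a y' <= max_centered y' by exact: le_max_centered.
  lra.
by apply: bigmax_le => [|a aS]; exact: H.
Qed.

Lemma sum_mean_centered : \sum_(a <- S) E (fun y => centered_count a y ^+ 2) <= B.
Proof.
apply: le_trans.
  apply: (sum_mean_sqr p_ge0 p_sum p_meas code_inj P_stationary p_cond Gamma_gt0
    c_ge0 c_supp (@sum_site_cost R D G n) osc_sqr_sum bmfun_centered centered_lip).
  by move=> u; exact: centered_dual.
by rewrite big1 ?add0r// => a _; rewrite mean_centered expr0n.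
Qed.

(** The maximum is dominated by the euclidean norm, whatever the number of words. *)
Lemma mean_max_centered : 0 < B -> E max_centered <= Num.sqrt B.
Proof.
move=> B0; set r := Num.sqrt B; have r0 : 0 < r by rewrite sqrtr_gt0.
have n2 a : bmfun (fun y => centered_count a y ^+ 2) by exact/bmfun_sqr/bmfun_centered.
(* 2 r Z a <= Z a ^+ 2 + r ^+ 2, and r ^+ 2 = B balances the two terms *)
have : E (fun y => 2 * r * max_centered y) <=
    E (fun y => \sum_(a <- S) centered_count a y ^+ 2 + r ^+ 2).
  apply: le_mean.
  - exact/bmfunZ/bmfun_max_centered.
  - by apply: bmfunD; [exact: bmfun_sum|exact: bmfun_cst].
  move=> y; rewrite -ler_pdivlMl ?mulr_gt0// /max_centered big_seq.
  have H a : a \in S -> centered_count a y <=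
      (2 * r)^-1 * (\sum_(a <- S) centered_count a y ^+ 2 + r ^+ 2).
    move=> aS; rewrite ler_pdivlMl ?mulr_gt0//.
    rewrite (big_rem a)//=.
    have : 0 <= \sum_(a' <- rem a S) centered_count a' y ^+ 2.
      by apply: sumr_ge0 => *; exact: sqr_ge0.
    have := sqr_ge0 (centered_count a y - r); nra.
  by apply: bigmax_le => [|a aS]; exact: H.
rewrite meanZ; last exact: bmfun_max_centered.
rewrite meanD; [|exact: bmfun_sum|exact: bmfun_cst].
rewrite mean_cst mean_sum//.
have := sum_mean_centered; rewrite -[X in _ <= X]sqr_sqrtr ?(ltW B0)// -/r => h1 h2.
rewrite -(ler_pM2l (_ : 0 < 2 * r)) ?mulr_gt0//; nra.
Qed.

(** A change of one window moves the difference by up to 2, so the concentration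
    bound is applied to its half. *)
Lemma mgf_centered s : 0 <= s ->
  E (fun y => expR (s * (max_centered y - centered_count a0 y))) <=
  expR (s * E max_centered + s ^+ 2 * B / 2).
Proof.
move=> s0.
pose f y := 2^-1 * (max_centered y - centered_count a0 y).
have nf' : bmfun (fun y => max_centered y - centered_count a0 y).
  by apply: bmfunB; [exact: bmfun_max_centered|exact: bmfun_centered].
have nf : bmfun f by exact: bmfunZ.
have cl_sym y y' : centered_count a0 y' - centered_count a0 y <= hamming_cost c n y y'.
  apply: (le_trans (centered_lip a0 y' y)).
  rewrite le_eqVlt; apply/orP; left; apply/eqP.
  by apply: eq_bigr => i _; rewrite eq_sym.
have lf : lipschitz_cost c n f.
  move=> y y'; rewrite /f; have := max_centered_lip y y'; have := cl_sym y y'; lra.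
have s2 : 0 <= 2 * s by rewrite mulr_ge0.
have := gaussian_concentration p_ge0 p_sum p_meas code_inj P_stationary p_cond Gamma_gt0
    c_ge0 c_supp (@sum_site_cost R D G n) osc_sqr_sum s2 nf lf.
have -> : (fun y => expR (2 * s * f y)) =
    (fun y => expR (s * (max_centered y - centered_count a0 y))).
  by apply/funext => y; congr expR; rewrite /f; field.
have Ef : E f = 2^-1 * E max_centered.
  rewrite /f meanZ// meanB ?mean_centered ?subr0//.
    exact: bmfun_max_centered.
  exact: bmfun_centered.
move/le_trans; apply; rewrite ler_expR Ef.
have -> : 2 * s * (2^-1 * E max_centered) = s * E max_centered by field.
have -> : (2 * s) ^+ 2 * B / 8 = s ^+ 2 * B / 2 by field; rewrite gt_eqF.
by [].
Qed.

Variable g : seqspace int A -> {ffun G -> A}.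
Hypothesis g_coords : forall x x',
  (forall j, 1 <= j <= n%:Z -> x j = x' j) -> g x = g x'.
Hypothesis g_max : forall x a,
  count_with n b (point_indicator a) x <= count_with n b (point_indicator (g x)) x.
Hypothesis joint_max : forall a, joint a <= joint a0.

(** The expected gap, restricted to the guesses in the finite list [S]. *)
Definition regret : R :=
  \sum_(a <- S) (joint a0 - joint a) * fine (P [set x | g x = a]).

Lemma measurable_guess a : measurable [set x | g x = a].
Proof. exact: measurable_sample_event cA g_coords. Qed.

(** If the guess [g x] is in [S], it is at least as frequent as [a0], which forces
    [max_centered - centered_count a0] to make up for the difference of the
    means. *)
Lemma regret_le (f : pastspace -> R) : bmfun f ->
  (forall y, 0 <= f y) ->
  (forall y a, a \in S ->
     m * (joint a0 - joint a) <= max_centered y - centered_count a0 y ->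
     joint a0 - joint a <= f y) ->
  regret <= E f.
Proof.
move=> nf f0 H.
have ng a : bmfun (fun x => (g x == a)%:R : R).
  by apply: bmfun_eq; exact: measurable_guess.
have ngu a : bmfun (fun y => (g (unpast y) == a)%:R : R).
  exact: (bmfun_comp (@measurable_unpast A n) (ng a)).
have -> : regret =
    E (fun y => \sum_(a <- S) (joint a0 - joint a) * (g (unpast y) == a)%:R).
  rewrite mean_sum => [|a]; last exact: bmfunZ.
  apply: eq_bigr => a _; rewrite meanZ//; congr (_ * _).
  rewrite (mean_unpast (ng a)).
    by rewrite Rintegral_eq//; exact: measurable_guess.
  by move=> x x' xx'; rewrite (g_coords (x' := x'))// => j /andP[_ /xx'].
apply: le_mean => //; first by apply: bmfun_sum => a; exact: bmfunZ.
move=> y; have [gS|gS] := boolP (g (unpast y) \in S); last first.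
  rewrite big1_seq// => a /andP[_ aS]; case: eqP => [e|_]; rewrite ?mulr0//.
  by move: gS; rewrite e aS.
rewrite (bigD1_seq (g (unpast y)))//= eqxx mulr1 big1 ?addr0; last first.
  by move=> a /negPf; rewrite eq_sym => ->; rewrite mulr0.
apply: H => //.
have h1 : centered_count (g (unpast y)) y <= max_centered y by exact: le_max_centered.
have h2 := g_max (unpast y) a0.
by move: h1; rewrite /centered_count; lra.
Qed.

Lemma regret_le_mean : 0 < m -> 0 < B -> regret <= Num.sqrt B / m.
Proof.
move=> m0 B0.
have nf : bmfun (fun y => m^-1 * (max_centered y - centered_count a0 y)).
  by apply: bmfunZ; apply: bmfunB; [exact: bmfun_max_centered|exact: bmfun_centered].
apply: (@le_trans _ _ (E (fun y => m^-1 * (max_centered y - centered_count a0 y)))).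
  apply: regret_le => // [y|y a aS].
    by rewrite mulr_ge0 ?invr_ge0 ?(ltW m0)// subr_ge0; exact: le_max_centered.
  by rewrite ler_pdivlMl.
rewrite meanZ; last by apply: bmfunB; [exact: bmfun_max_centered|exact: bmfun_centered].
rewrite meanB; [|exact: bmfun_max_centered|exact: bmfun_centered].
rewrite mean_centered subr0 mulrC ler_pM2r ?invr_gt0//.
exact: mean_max_centered.
Qed.

(** Chernoff's bound with parameter [s]: a positive gap is at most [bet] and
    requires a deviation of at least [m * del]. *)
Lemma regret_le_tail (s del bet : R) : 0 <= s -> 0 < B -> 0 <= bet ->
  (forall a, joint a0 - joint a <= bet) ->
  (forall a, joint a < joint a0 -> del <= joint a0 - joint a) ->
  regret <= bet * expR (s * Num.sqrt B + s ^+ 2 * B / 2 - s * (m * del)).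
Proof.
move=> s0 B0 bet0 Hbet Hdel.
pose F y := max_centered y - centered_count a0 y.
have nF : bmfun F by apply: bmfunB; [exact: bmfun_max_centered|exact: bmfun_centered].
pose f y := (bet * expR (- (s * (m * del)))) * expR (s * F y).
have nf : bmfun f by apply: bmfunZ; exact: bmfun_expR.
apply: (@le_trans _ _ (E f)).
  apply: regret_le => // [y|y a aS Fy].
    by rewrite /f !mulr_ge0// expR_ge0.
  have [lt_a|ge_a] := ltP (joint a) (joint a0); last first.
    by rewrite (@le_trans _ _ 0) ?subr_le0// /f !mulr_ge0// expR_ge0.
  rewrite (le_trans (Hbet a))// /f -mulrA -expRD ler_peMr//.
  have h1 : m * del <= F y by rewrite (le_trans _ Fy)// ler_wpM2l// Hdel.
  by rewrite (le_trans _ (expR_ge1Dx _))// lerDl addrC subr_ge0 ler_wpM2l.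
rewrite /f meanZ; last exact: bmfun_expR.
rewrite -mulrA ler_wpM2l//.
rewrite [leRHS](_ : _ =
  expR (- (s * (m * del))) * expR (s * Num.sqrt B + s ^+ 2 * B / 2)); last first.
  by rewrite -expRD; congr expR; ring.
rewrite ler_pM2l ?expR_gt0//; apply: (le_trans (mgf_centered s0)).
by rewrite ler_expR lerD2r ler_wpM2l// mean_max_centered.
Qed.

End regret.

(** * Tightness on a countable set *)

Lemma seq_argmax (R : realType) (V : eqType) (f : V -> R) (v0 : V) (s : seq V) :
  exists2 v, v \in v0 :: s & forall w, w \in v0 :: s -> f w <= f v.
Proof.
elim: s => [|v s [u us fu]].
  by exists v0; rewrite ?mem_head// => w; rewrite inE => /eqP ->.
have [fuv|fvu] := leP (f u) (f v).
  exists v; first by rewrite !inE eqxx orbT.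
  move=> w; rewrite !inE orbCA => /orP[/eqP->//|ws].
  by rewrite (le_trans _ fuv)// fu// inE.
exists u; first by move: us; rewrite !inE => /orP[->//|->]; rewrite !orbT.
move=> w; rewrite !inE orbCA => /orP[/eqP->|ws]; first exact: ltW.
by rewrite fu// inE.
Qed.

Section tightness.
Context d (T : measurableType d) (R : realType) (P : probability T R).
Variables (V : eqType) (W : T -> V) (vcode : V -> nat).
Hypothesis vcode_inj : injective vcode.
Hypothesis mW : forall v, measurable [set x | W x = v].

Lemma code_initial_segment k :
  exists2 S : seq V, uniq S & forall v, (v \in S) = (vcode v < k)%N.
Proof.
elim: k => [|k [S uS SE]]; first by exists [::].
have [[v vk]|no] := pselect (exists v, vcode v = k).
  exists (v :: S) => [|w]; first by rewrite /= uS SE vk ltnn.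
  rewrite inE SE ltnS [RHS]leq_eqVlt -vk; congr (_ || _).
  by rewrite (inj_eq vcode_inj).
exists S => // w; rewrite SE ltnS [RHS]leq_eqVlt.
by case: eqP => // wk; exfalso; apply: no; exists w.
Qed.

Lemma sum_eq_mem (S : seq V) x : uniq S ->
  \sum_(v <- S) (W x == v)%:R = (W x \in S)%:R :> R.
Proof.
move=> uS; have [WS|WS] := boolP (W x \in S).
  rewrite (bigD1_seq (W x))//= eqxx big1 ?addr0// => v /negPf.
  by rewrite eq_sym => ->.
rewrite big1_seq// => v /andP[_ vS]; case: eqP => // e.
by move: WS; rewrite e vS.
Qed.

Lemma bmfun_mem (S : seq V) : uniq S -> bmfun (fun x => (W x \in S)%:R : R).
Proof.
move=> uS; rewrite (_ : (fun x => _) = fun x => \sum_(v <- S) (W x == v)%:R).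
  by apply: bmfun_sum => v; exact: bmfun_eq.
by apply/funext => x; rewrite sum_eq_mem.
Qed.

Lemma probability_mem (S : seq V) : uniq S ->
  \int[P]_x (W x \in S)%:R = \sum_(v <- S) fine (P [set x | W x = v]).
Proof.
move=> uS; rewrite -(eq_bigr _ (fun v _ => Rintegral_eq P (mW v))).
rewrite -Rintegral_sum; last by move=> v; exact: bmfun_eq.
by congr Rintegral; apply/funext => x; rewrite sum_eq_mem.
Qed.

Lemma sum_probability_le1 (S : seq V) : uniq S ->
  \sum_(v <- S) fine (P [set x | W x = v]) <= 1.
Proof.
move=> uS; rewrite -probability_mem//.
rewrite -[leRHS](Rintegral_prob_cst P); apply: le_Rintegral => //.
- by apply: bmfun_integrable; exact: bmfun_mem.
- by apply: bmfun_integrable; exact: bmfun_cst.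
- by move=> x _; case: (_ \in _).
Qed.

Lemma tight (eta : R) : 0 < eta ->
  exists2 S : seq V, uniq S & 1 - eta <= \sum_(v <- S) fine (P [set x | W x = v]).
Proof.
move=> eta0; pose E k := [set x | (vcode (W x) < k)%N].
have mE k : measurable (E k).
  have [S uS SE] := code_initial_segment k.
  have [mS _] := bmfun_mem uS.
  rewrite (_ : E k = (fun x => (W x \in S)%:R : R) @^-1` [set 1]).
    by rewrite -[X in measurable X]setTI; exact: mS.
  apply/seteqP; split=> x; rewrite /E/= SE; first by move=> ->.
  by case: (_ < _)%N => //= /eqP; rewrite eq_sym oner_eq0.
have EU : \bigcup_k E k = [set: T].
  by apply/seteqP; split=> // x _; exists (vcode (W x)).+1 => //=; rewrite /E/=.
have := @nondecreasing_cvg_mu _ _ _ P E mE.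
rewrite EU => /(_ measurableT) cvgE.
have ndE : {homo E : k l / (k <= l)%N >-> (k <= l)%O}.
  by move=> k l kl; apply/subsetPset => x /= h; exact: leq_trans kl.
have {}cvgE := cvgE ndE.
rewrite [X in _ --> X](_ : _ = 1%:E) in cvgE; last exact: (probability_setT P).
have /fine_cvgP[_ /cvgrPdist_le /(_ _ eta0) [k _ /(_ k (leqnn k))]] := cvgE.
rewrite /= => h.
have [S uS SE] := code_initial_segment k; exists S => //.
rewrite -probability_mem//.
have -> : \int[P]_x (W x \in S)%:R = fine (P (E k)).
  rewrite /Rintegral; congr fine.
  rewrite -[E k]setIT -integral_indic//; apply: eq_integral => x _.
  rewrite indicE SE; congr (_%:R%:E); congr nat_of_bool.
  by apply/idP/idP => [h'|]; [rewrite mem_set|rewrite inE].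
by move: h; rewrite ler_norml => /andP[_]; lra.
Qed.

End tightness.

(** * From the excess risk to the regret *)

Section risk_at.
Variables (R : realType) (A : pointedType) (code : A -> nat).
Hypothesis code_inj : injective code.
Variable P : probability (seqspace int A) R.
Variables (D G : {fset int}) (n : nat).
Implicit Types (x : seqspace int A) (b : {ffun D -> A}) (a : {ffun G -> A}).

Let cA : countable [set: A].
Proof. by apply/countable_injP; exists code => a a' _ _; exact: code_inj. Qed.

Definition ffun_code (H : {fset int}) (f : {ffun H -> A}) : nat :=
  choice.pickle [ffun i => code (f i)].

Lemma ffun_code_inj H : injective (@ffun_code H).
Proof.
move=> f f' /(pcan_inj choice.pickleK)/ffunP ff'; apply/ffunP => i.
by have := ff' i; rewrite !ffunE => /code_inj.
Qed.

Definition data_prob b : R := fine (P [set x | restr D x = b]).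

Lemma measurable_joint b a : measurable [set x | restr G x = a /\ restr D x = b].
Proof.
by apply: (@measurableI _ _ [set x | restr G x = a] [set x | restr D x = b]);
  exact: measurable_restr.
Qed.

Lemma joint_ge0 b a : 0 <= joint P b a.
Proof. by rewrite /joint fine_ge0. Qed.

Lemma jointE b a : (joint P b a)%:E = P [set x | restr G x = a /\ restr D x = b].
Proof. by rewrite /joint fineK// fin_num_measure//; exact: measurable_joint. Qed.

Lemma data_probE b : (data_prob b)%:E = P [set x | restr D x = b].
Proof. by rewrite /data_prob fineK// fin_num_measure//; exact: measurable_restr. Qed.

Lemma joint_le_fiber b a : joint P b a <= fine (P [set x | restr G x = a]).
Proof.
have mG : measurable [set x | restr G x = a] by exact: measurable_restr.
rewrite -lee_fin jointE fineK ?fin_num_measure//; apply: le_measure.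
- by rewrite inE; exact: measurable_joint.
- by rewrite inE.
- by move=> x [].
Qed.

Lemma joint_le1 b a : joint P b a <= 1.
Proof.
by rewrite -lee_fin jointE probability_le1//; exact: measurable_joint.
Qed.

Lemma miss_prob b a :
  P [set x | restr G x <> a /\ restr D x = b] = (data_prob b - joint P b a)%:E.
Proof.
have mG : measurable [set x | restr G x = a] by exact: measurable_restr.
have mD : measurable [set x | restr D x = b] by exact: measurable_restr.
rewrite EFinB jointE data_probE.
rewrite (_ : [set x | restr G x <> a /\ _] =
    [set x | restr D x = b] `\` [set x | restr G x = a]); last first.
  by apply/seteqP; split=> x [? ?]; split.
rewrite measureD//; last by apply: (le_lt_trans (probability_le1 P mD)); exact: ltry.
by congr (_ - P _)%E; apply/seteqP; split=> x [? ?]; split.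
Qed.

(** The alphabet may be infinite: outside a finite set of large probability all the
    values are smaller than a given positive one. *)
Lemma joint_argmax b : exists a0, forall a, joint P b a <= joint P b a0.
Proof.
have [[a1 a1_gt0]|no] := pselect (exists a, 0 < joint P b a); last first.
  exists [ffun=> point] => a; rewrite (le_trans _ (joint_ge0 _ _))// leNgt.
  by apply/negP => a_gt0; apply: no; exists a.
(* S has probability at least 1 - joint a1 / 2, so words outside S are beaten by a1 *)
have half : 0 < joint P b a1 / 2 by rewrite divr_gt0.
have mG a : measurable [set x | restr G x = a] by exact: measurable_restr.
have [S uS SP] := tight P (@ffun_code_inj G) mG half.
have [a0 _ a0_max] := seq_argmax (joint P b) a1 S.
exists a0 => a; have [aS|aS] := boolP (a \in a1 :: S); first exact: a0_max.
move: aS; rewrite inE negb_or => /andP[_ aS].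
have := @sum_probability_le1 _ _ _ P _ _ mG (a :: S).
rewrite /= aS uS big_cons => /(_ isT) h.
have h1 := joint_le_fiber b a; have h2 := a0_max _ (mem_head _ _).
have := SP; move: a1_gt0 h h1 h2; move: (\sum_(v <- S) _) => s; lra.
Qed.

Section fixed_data.
Variables (b : {ffun D -> A}) (a0 : {ffun G -> A}).
Hypothesis a0_max : forall a, joint P b a <= joint P b a0.

Lemma inf_joint_le a : inf (range (@joint R A P D G b)) <= joint P b a.
Proof.
apply: ge_inf; last by exists a.
by exists 0 => _ [a' _ <-]; exact: joint_ge0.
Qed.

Lemma sup_joint : sup (range (@joint R A P D G b)) = joint P b a0.
Proof.
apply/le_anti/andP; split.
  by apply: ge_sup; [exists (joint P b a0), a0|move=> _ [a _ <-]].
apply: ub_le_sup; last by exists a0.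
by exists 1 => _ [a _ <-]; exact: joint_le1.
Qed.

Lemma joint_gap_le_beta a : joint P b a0 - joint P b a <= beta P D G.
Proof.
apply: (@le_trans _ _
  (sup (range (@joint R A P D G b)) - inf (range (@joint R A P D G b)))).
  by rewrite sup_joint lerD2l lerN2 inf_joint_le.
apply: ub_le_sup; last by exists b.
exists 1 => _ [b' _ <-] /=.
have h1 : sup (range (@joint R A P D G b')) <= 1.
  apply: ge_sup; first by exists (joint P b' a0), a0.
  by move=> _ [a' _ <-]; exact: joint_le1.
have h2 : 0 <= inf (range (@joint R A P D G b')).
  apply: lb_le_inf; first by exists (joint P b' a0), a0.
  by move=> _ [a' _ <-]; exact: joint_ge0.
by rewrite lerBlDl (le_trans h1)// lerDr.
Qed.

Lemma margin_at_ge0 b' : 0 <= margin_at P G b'.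
Proof.
rewrite /margin_at; set E := [set r | _].
have [->|/set0P E0] := eqVneq E set0; first by rewrite inf0.
by apply: lb_le_inf => // r [/ltW].
Qed.

Lemma margin_le_gap a : joint P b a < joint P b a0 ->
  margin P D G <= joint P b a0 - joint P b a.
Proof.
move=> lt_a; apply: (@le_trans _ _ (margin_at P G b)).
  apply: ge_inf; last by exists b.
  by exists 0 => _ [b' _ <-]; exact: margin_at_ge0.
apply: ge_inf; first by exists 0 => r [/ltW].
split; first by rewrite subr_gt0.
exists a; rewrite miss_prob/=.
rewrite [inf _](_ : _ = data_prob b - joint P b a0); first by lra.
apply/le_anti/andP; split.
  apply: ge_inf; last by exists a0 => //; rewrite miss_prob.
  by exists 0 => _ [a' _ <-]; rewrite fine_ge0.
apply: lb_le_inf.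
  by exists (data_prob b - joint P b a0), a0 => //; rewrite miss_prob.
by move=> _ [a' _ <-]; rewrite miss_prob/= lerD2l lerN2.
Qed.

Variable fhat : n.-tuple A -> {ffun D -> A} -> {ffun G -> A}.
Local Notation g := (fun x => fhat (sample n x) b).

Lemma guess_coords x x' : (forall j, 1 <= j <= n%:Z -> x j = x' j) -> g x = g x'.
Proof.
by move=> xx'; congr (fhat _ b); exact: eq_sample.
Qed.

Lemma measurable_fhat a : measurable [set x | g x = a].
Proof. exact: measurable_sample_event cA guess_coords. Qed.

Lemma bmfun_gap : bmfun (fun x => joint P b a0 - joint P b (g x)).
Proof.
split.
  apply: (@measurable_fun_finite_coords _ _ (sample_sites n)) => // x x' xx'.
  congr (_ - joint P b _); apply: guess_coords => j jn.
  by apply: xx'; rewrite mem_sample_sites.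
exists 1 => x; rewrite ler_norml.
have := joint_ge0 b (g x); have := joint_le1 b a0; have := a0_max (g x); lra.
Qed.

(** Outside a finite list of guesses of probability close to 1 the gap is at most
    1. *)
Lemma mean_gap_le (bound : R) :
  (forall S, uniq S -> a0 \in S -> regret P b S a0 g <= bound) ->
  \int[P]_x (joint P b a0 - joint P b (g x)) <= bound.
Proof.
move=> H; apply/ler_addgt0Pr => eta eta0.
have [S1 uS1 S1P] := tight P (@ffun_code_inj G) measurable_fhat eta0.
have [S [uS a0S SP]] : exists S, [/\ uniq S, a0 \in S &
    1 - eta <= \sum_(v <- S) fine (P [set x | g x = v])].
  have [aS|aS] := boolP (a0 \in S1); first by exists S1.
  exists (a0 :: S1); rewrite /= aS uS1 mem_head; split=> //.
  by rewrite big_cons ler_wpDl// fine_ge0.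
have ng a : bmfun (fun x => (g x == a)%:R : R) by apply: bmfun_eq; exact: measurable_fhat.
have nZ a : bmfun (fun x => (joint P b a0 - joint P b a) * (g x == a)%:R).
  exact: bmfunZ.
have n1 : bmfun (fun x => 1 - (g x \in S)%:R : R).
  by apply: bmfunB; [exact: bmfun_cst|exact: (bmfun_mem _ measurable_fhat)].
apply: (@le_trans _ _ (\int[P]_x
    (\sum_(a <- S) (joint P b a0 - joint P b a) * (g x == a)%:R + (1 - (g x \in S)%:R)))).
  apply: le_Rintegral => //.
  - by apply: bmfun_integrable; exact: bmfun_gap.
  - by apply: bmfun_integrable; apply: bmfunD => //; exact: bmfun_sum.
  move=> x _; have [gS|gS] := boolP (g x \in S).
    rewrite (bigD1_seq (g x))//= eqxx mulr1 subrr addr0 lerDl sumr_ge0// => a _.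
    by rewrite mulr_ge0// subr_ge0.
  rewrite subr0 ler_wpDl//; last first.
    by have := joint_le1 b a0; have := joint_ge0 b (g x); lra.
  by apply: sumr_ge0 => a _; rewrite mulr_ge0// subr_ge0.
rewrite RintegralD//; try by apply: bmfun_integrable; rewrite ?n1//; exact: bmfun_sum.
apply: lerD.
  rewrite Rintegral_sum//; apply: le_trans (H _ uS a0S); rewrite /regret.
  apply: ler_sum => a _; rewrite RintegralZl//; last first.
    by apply: bmfun_integrable; exact: ng.
  by rewrite Rintegral_eq//; exact: measurable_fhat.
rewrite RintegralB//; last 2 first.
- by apply: bmfun_integrable; exact: bmfun_cst.
- by apply: bmfun_integrable; exact: (bmfun_mem _ measurable_fhat).
by rewrite Rintegral_prob_cst (probability_mem P measurable_fhat)// lerBlDl -lerBlDr.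
Qed.

(** Sections of the product measure at a sample [x] turn the error probability into
    the integral of [data_prob b - joint b (g x)], and the infimum is attained at
    [a0]. *)
Lemma excess_term_le (bound : R) : 0 <= bound ->
  (\int[P]_x (joint P b a0 - joint P b (g x))) <= bound ->
  let PP := (P \x P)%E in
  let YD_b := [set z : seqspace int A * seqspace int A | restr D z.2 = b] in
  (cond_prob PP
     [set z | fhat (sample n z.1) (restr D z.2) <> restr G z.2] YD_b
   - inf (range (fun a : {ffun G -> A} =>
            cond_prob PP [set z | a <> restr G z.2] YD_b)))
  * fine (PP YD_b) <= bound.
Proof.
move=> bound0 gap_le; cbv zeta; set PP := (P \x P)%E; set YD_b := [set z | _ = b].
have PPYD : PP YD_b = (data_prob b)%:E.
  rewrite /PP /product_measure1; under eq_integral => x _.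
    rewrite /= (_ : xsection YD_b x = [set y | restr D y = b]); last first.
      by rewrite xsectionE.
    rewrite -data_probE; over.
  exact: integral_prob_cst.
have PPmiss a : PP ([set z | a <> restr G z.2] `&` YD_b) =
    (data_prob b - joint P b a)%:E.
  rewrite /PP /product_measure1; under eq_integral => x _.
    rewrite /= (_ : xsection _ x =
      [set y | restr G y <> a /\ restr D y = b]); last first.
      by rewrite xsectionE; apply/seteqP; split=> y [/= h e]; split=> //= e'; exact: h.
    rewrite miss_prob; over.
  exact: integral_prob_cst.
have PPhat : fine (PP
    ([set z | fhat (sample n z.1) (restr D z.2) <> restr G z.2] `&` YD_b)) =
    \int[P]_x (data_prob b - joint P b (g x)).
  rewrite /Rintegral /PP /product_measure1; congr fine; apply: eq_integral => x _ /=.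
  rewrite (_ : xsection _ x = [set y | restr G y <> g x /\ restr D y = b]); last first.
    rewrite xsectionE; apply/seteqP; split=> y [/= h e]; split=> //.
      by move=> e'; apply: h; rewrite e e'.
    by rewrite /= e => e'; exact: h.
  by rewrite miss_prob.
rewrite PPYD [fine _]/=.
have [->|pb_neq0] := eqVneq (data_prob b) 0; first by rewrite mulr0.
have pb_gt0 : 0 < data_prob b by rewrite lt_def pb_neq0 fine_ge0.
rewrite /cond_prob PPYD PPhat [fine (data_prob b)%:E]/=.
rewrite mulrBl divfK//.
have inf_ge : (data_prob b - joint P b a0) / data_prob b <=
    inf (range (fun a : {ffun G -> A} =>
       fine (PP ([set z | a <> restr G z.2] `&` YD_b)) / data_prob b)).
  apply: lb_le_inf; first by eexists; exists a0.
  move=> _ [a _ <-]; rewrite PPmiss/= ler_pM2r ?invr_gt0//.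
  by rewrite lerD2l lerN2.
rewrite ler_pdivrMr// in inf_ge.
have : \int[P]_x (joint P b a0 - joint P b (g x)) =
    \int[P]_x (data_prob b - joint P b (g x)) - (data_prob b - joint P b a0).
  rewrite -[X in _ = _ - X](Rintegral_prob_cst P).
  rewrite -RintegralB//.
  - by apply: eq_Rintegral => x _; ring.
  - apply: bmfun_integrable.
    have := bmfunD bmfun_gap (@bmfun_cst _ _ R (data_prob b - joint P b a0)).
    by congr bmfun; apply/funext => x; ring.
  - by apply: bmfun_integrable; exact: bmfun_cst.
lra.
Qed.

End fixed_data.
End risk_at.

(** * The number of windows *)

Section window_size.
Variables (D G : {fset int}).

Lemma site_le_diam (j : int) : fset_min (G `|` D)%fset = 1 ->
  j \in sites D G -> 1 <= j <= diam (G `|` D)%fset.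
Proof.
move=> minE js.
have jU : j \in enum_fset (G `|` D)%fset.
  by move: js; rewrite mem_cat => jDG; rewrite in_fsetE orbC.
rewrite /diam minE subrK -minE; apply/andP; split.
  have h (z : int) s : j \in s -> \big[Num.min/z]_(i <- s) i <= j.
    elim: s => // k s IH; rewrite inE big_cons ge_min.
    by move=> /orP[/eqP ->|/IH ->]; rewrite ?lexx ?orbT.
  exact: h.
exact: (le_bigmax_seq _ j xpredT (@id int) jU).
Qed.

Lemma sites_neq_nil : fset_min (G `|` D)%fset = 1 -> (0 < size (sites D G))%N.
Proof.
move=> minE; rewrite lt0n; apply/negP => /eqP/size0nil s0.
have U0 : enum_fset (G `|` D)%fset = [::].
  apply/eqP; rewrite -size_eq0 size_eq0; apply/eqP; case E : (enum_fset _) => [//|j s].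
  have : j \in enum_fset (G `|` D)%fset by rewrite E mem_head.
  by rewrite in_fsetE orbC -mem_cat -/(sites D G) s0.
by move: minE; rewrite /fset_min U0 big_nil.
Qed.

Lemma diam_pos : fset_min (G `|` D)%fset = 1 ->
  exists2 d : nat, (0 < d)%N & diam (G `|` D)%fset = d%:Z.
Proof.
move=> minE; have [j js] : exists j, j \in sites D G.
  have := sites_neq_nil minE; case: (sites D G) => // j s _.
  by exists j; rewrite mem_head.
have /andP[j1 jd] := site_le_diam minE js.
by case: (diam _) jd => [d|d] jd; [exists d => //|]; lia.
Qed.

Lemma valid_count_ge (n d : nat) : (0 < d <= n)%N ->
  (forall j, j \in sites D G -> 1 <= j <= d%:Z) ->
  (n - d < valid_count D G n)%N.
Proof.
move=> /andP[d0 dn] jd; rewrite /valid_count.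
have fits (z : int) i : 1 <= z <= d%:Z -> (i < (n - d).+1)%N -> 1 <= z + i%:Z <= n%:Z.
  by move: dn; clear; lia.
have v_i i : (i < (n - d).+1)%N -> valid D G n i.
  move=> i_nd; apply/andP; split; apply/forallP => j; apply: fits => //;
    by apply: jd; rewrite mem_cat (valP j) ?orbT.
have nd : ((n - d).+1 <= n)%N by lia.
rewrite -[X in (X <= _)%N]card_ord -sum1_card.
rewrite (big_ord_widen n (fun=> 1%N) nd) [X in (X <= _)%N]big_mkcond.
rewrite [X in (_ <= X)%N]big_mkcond/=.
by apply: leq_sum => i _; case: ifPn => // id; rewrite v_i.
Qed.

End window_size.

(** * Numerical estimates *)

Section numeric.
Variable R : realType.
Implicit Types m q eps del bet : R.

Lemma expR_half_le2 : expR (2^-1) <= 2 :> R.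
Proof.
have := expR_ge1Dx (- 2^-1 : R); rewrite expRN => h.
have e0 : 0 < expR (2^-1 : R) by exact: expR_gt0.
have := ler_wpM2r (ltW e0) h; rewrite mulVf ?gt_eqF//; lra.
Qed.

Lemma half_le_ln2 (r : R) : 2 <= r -> 2^-1 <= ln r.
Proof.
move=> r2; have r0 : 0 < r by rewrite (lt_le_trans _ r2).
by rewrite -ler_expR lnK ?posrE// (le_trans expR_half_le2).
Qed.

(** The case where the margin is at most half of [eps]. *)
Lemma mean_regime m q eps lam : 0 < m -> 0 < q -> 0 < eps -> 2^-1 <= lam ->
  4 * q ^+ 2 * lam <= m * (eps / 2) ^+ 2 ->
  Num.sqrt (m * q ^+ 2) / m <= eps.
Proof.
move=> m0 q0 eps0 lam2 h.
rewrite ler_pdivrMr//.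
have -> : eps * m = Num.sqrt ((eps * m) ^+ 2).
  by rewrite sqrtr_sqr ger0_norm// mulr_ge0// ltW.
rewrite ler_sqrt ?sqr_ge0//.
have q2 : 0 < q ^+ 2 by rewrite exprn_gt0.
have : q ^+ 2 <= m * eps ^+ 2.
  have : q ^+ 2 * 2^-1 <= q ^+ 2 * lam by rewrite ler_pM2l.
  have : 0 <= m * eps ^+ 2 by rewrite mulr_ge0 ?sqr_ge0 ?ltW.
  nra.
rewrite exprMn => h1.
rewrite [leRHS](_ : _ = m * (m * eps ^+ 2)) ?ler_pM2l//; ring.
Qed.

(** The case of a large margin. In terms of [w = m * del / r], where [r] is the square
    root of [m * q ^+ 2], the optimal exponent is [- (w - 1) ^+ 2 / 2]; since
    [w ^+ 2 >= 4 * lam], it is at most [1 / 2 - lam], and [exp (1 / 2) <= 2]. *)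
Lemma tail_regime m q eps del bet : 0 < m -> 0 < q -> 0 < eps -> 0 < bet -> 0 <= del ->
  2^-1 <= ln (2 * bet / eps) ->
  4 * q ^+ 2 * ln (2 * bet / eps) <= m * del ^+ 2 ->
  exists2 s, 0 <= s & bet * expR (s * Num.sqrt (m * q ^+ 2) + s ^+ 2 * (m * q ^+ 2) / 2
                       - s * (m * del)) <= eps.
Proof.
move=> m0 q0 eps0 bet0 del0 lam2 h; set lam := ln _ in lam2 h *.
have B0 : 0 < m * q ^+ 2 by rewrite mulr_gt0// exprn_gt0.
set r := Num.sqrt _.
have r0 : 0 < r by rewrite sqrtr_gt0.
have rE : r ^+ 2 = m * q ^+ 2 by rewrite sqr_sqrtr// ltW.
rewrite -rE.
pose w := m * del / r.
have mE : m * del = w * r by rewrite /w divfK// gt_eqF.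
have w0 : 0 <= w by apply: divr_ge0; [apply: mulr_ge0 => //; exact: ltW|exact: ltW].
have w2 : 4 * lam <= w ^+ 2.
  rewrite /w expr_div_n rE ler_pdivlMr//.
  have : m * (4 * q ^+ 2 * lam) <= m * (m * del ^+ 2) by rewrite ler_pM2l.
  by rewrite exprMn; nra.
have w1 : 1 <= w.
  have : 1 <= w ^+ 2 by lra.
  by rewrite -[X in X <= _ -> _](expr1n _ 2) ler_sqr ?nnegrE.
exists ((w - 1) / r); first by rewrite divr_ge0 ?subr_ge0// ltW.
rewrite mE.
have -> : (w - 1) / r * r + ((w - 1) / r) ^+ 2 * r ^+ 2 / 2 - (w - 1) / r * (w * r) =
    - (w - 1) ^+ 2 / 2 by field; rewrite gt_eqF.
have epsE : eps = 2 * bet * expR (- lam).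
  rewrite expRN /lam lnK; last by rewrite posrE divr_gt0 ?mulr_gt0.
  by field; rewrite !gt_eqF.
rewrite epsE -mulrA [2 * _]mulrC -mulrA ler_pM2l//.
have : - (w - 1) ^+ 2 / 2 <= - lam + 2^-1.
  have := sqr_ge0 (w / 2 - 1); nra.
rewrite -ler_expR expRD => /le_trans; apply.
by rewrite ler_pM2l ?expR_gt0// expR_half_le2.
Qed.

Lemma sample_longer_than_window (t Y N L : R) : 0 < t -> t <= 1 -> 0 <= Y ->
  4 / t ^+ 2 * (Y + 2) + L - 2 <= N -> L <= N.
Proof.
move=> t0 t1 Y0; have t2 : 0 < t ^+ 2 by rewrite exprn_gt0.
have : 1 <= (t ^+ 2)^-1 by rewrite invf_ge1// expr_le1// ltW.
move: (t ^+ 2)^-1 => u u1; have : 0 <= (u - 1) * Y by rewrite mulr_ge0// subr_ge0.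
nra.
Qed.

Lemma enough_windows (t Y N L m : R) : 0 < t -> t <= 1 ->
  4 / t ^+ 2 * (Y + 2) + L - 2 <= N -> N - L + 1 <= m -> 4 * Y <= m * t ^+ 2.
Proof.
move=> t0 t1 h Nm; have t2 : 0 < t ^+ 2 by rewrite exprn_gt0.
have t2_le1 : t ^+ 2 <= 1 by rewrite expr_le1// ltW.
have : 4 * (Y + 2) <= (N - L + 2) * t ^+ 2.
  by rewrite -ler_pdivrMr// mulrAC; lra.
have : (N - L + 1) * t ^+ 2 <= m * t ^+ 2 by rewrite ler_pM2r.
lra.
Qed.

End numeric.

(** * The bound on the excess risk *)

Unset Implicit Arguments.
Set Strict Implicit.
Set Printing Implicit Defensive.
Local Close Scope classical_set_scope.

Theorem theorem3p1 (R : realType) (A : pointedType)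
  (A_countable : countable [set: A]%classic)
  (A_two : exists a a' : A, a <> a')
  (G D : {fset int}) (min_GD : fset_min (G `|` D)%fset = 1)
  (P : probability (seqspace int A) R) (P_stationary : stationary P)
  (p : A -> seqspace Zneg A -> R) (p_left : left_cond_expectations P p)
  (Gamma_gt0 : 0 < Gamma p)
  (eps : R) (eps_gt0 : 0 < eps)
  (n : nat) (fhat : n.-tuple A -> {ffun D -> A} -> {ffun G -> A})
  (fhat_estimator : is_estimator R fhat) :
  let L : R := (diam (G `|` D)%fset)%:~R in
  let K : R := (#|` G| + #|` D|)%N%:R in
  4 / (Num.max (eps / 2) (margin P D G)) ^+ 2
    * ((K / Gamma p) ^+ 2 * ln (2 * beta P D G / eps)
       + 4 * K * (1 - Gamma p) / Gamma p + 2)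
    + L - 2 <= n%:R ->
  excess_risk P fhat <= Num.min eps (beta P D G).
Proof.
move=> L K n_large.
have [code0 code0_inj] := countable_injP _ A_countable.
have code_inj : injective code0 by move=> a a'; apply: code0_inj; exact: mem_setT.
have [p_ge0 p_sum p_meas p_cond] := p_left.
rewrite /excess_risk; apply: ge_sup.
  by eexists; exists [ffun=> point].
move=> _ [b _ <-].
have [a0 a0_max] := joint_argmax code_inj P G b.
have gap_beta a := joint_gap_le_beta code_inj a0_max a.
have beta_ge0 : 0 <= beta P D G.
  by have := gap_beta a0; rewrite subrr.
apply: (excess_term_le code_inj a0_max).
  by rewrite le_min (ltW eps_gt0).
apply: (mean_gap_le code_inj a0_max) => S uS a0S.
pose g := fun x => fhat (sample n x) b.
have g_coords := guess_coords b fhat.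
have mg a : measurable [set x | g x = a]%classic.
  exact: measurable_sample_event A_countable g_coords.
have regret_le_gap (r : R) : 0 <= r ->
    (forall a : {ffun G -> A}, joint P b a0 - joint P b a <= r) ->
    regret P b S a0 g <= r.
  move=> r0 gap_r; set sP := \sum_(a <- S) fine (P [set x | g x = a]%classic).
  have sP_le1 : sP <= 1 by exact: sum_probability_le1.
  apply: (@le_trans _ _ (r * sP)); last by rewrite ler_piMr.
  rewrite /regret mulr_sumr; apply: ler_sum => a _.
  by rewrite ler_wpM2r// fine_ge0.
rewrite le_min; apply/andP; split; last exact: regret_le_gap.
have [|eps_beta] := leP (beta P D G) eps.
  by apply: le_trans; exact: regret_le_gap.
(* from now on eps < 1, so that the threshold t is at most 1 *)
have [|eps_1] := leP 1 eps.
  apply: le_trans; apply: regret_le_gap => // a.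
  by rewrite lerBlDl (le_trans (joint_le1 code_inj P b a0))// lerDr joint_ge0.
have [[a1 a1_lt]|no_gap] :=
  pselect (exists a : {ffun G -> A}, joint P b a < joint P b a0); last first.
  rewrite /regret big1 ?ltW// => a _.
  rewrite [joint P b a0](_ : _ = joint P b a) ?subrr ?mul0r//.
  apply/le_anti; rewrite a0_max andbT leNgt; apply/negP => lt_a.
  by apply: no_gap; exists a.
set del := margin P D G in n_large.
have del_le : del <= joint P b a0 - joint P b a1.
  exact: (margin_le_gap code_inj a0_max).
have del_le1 : del <= 1.
  by have := joint_le1 code_inj P b a0; have := joint_ge0 P b a1; lra.
have beta_gt0 : 0 < beta P D G by exact: lt_trans eps_beta.
set t := Num.max (eps / 2) del in n_large.
have t_gt0 : 0 < t by rewrite lt_max divr_gt0.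
have t_le1 : t <= 1 by rewrite ge_max del_le1 andbT; lra.
set lam := ln (2 * beta P D G / eps) in n_large.
have lam_ge : 2^-1 <= lam.
  by apply: half_le_ln2; rewrite ler_pdivlMr// ler_pM2l// ltW.
have KE : K = (size (sites D G))%:R by rewrite /sites size_cat addnC.
have K_gt0 : 0 < K by rewrite KE ltr0n sites_neq_nil.
set q := K / Gamma p in n_large.
have q_gt0 : 0 < q by rewrite divr_gt0.
have Gamma_le1 : Gamma p <= 1.
  by have := Gamma_le p_ge0 p_sum code_inj 0; rewrite big_geq.
set X := 4 * K * (1 - Gamma p) / Gamma p in n_large.
have X_ge0 : 0 <= X.
  rewrite divr_ge0 ?(ltW Gamma_gt0)// !mulr_ge0 ?(ltW K_gt0)//.
  by rewrite subr_ge0.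
have q2lam_ge0 : 0 <= q ^+ 2 * lam.
  by rewrite mulr_ge0 ?sqr_ge0// (le_trans _ lam_ge)// invr_ge0.
have [d d_gt0 dE] := diam_pos min_GD.
have LE : L = d%:R by rewrite /L dE.
have d_le_n : (d <= n)%N.
  rewrite -(ler_nat R) -LE.
  apply: (sample_longer_than_window t_gt0 t_le1 _ n_large).
  exact: addr_ge0.
have m_ge : n%:R - L + 1 <= (valid_count D G n)%:R.
  rewrite LE -natrB// natr1 ler_nat.
  apply: valid_count_ge => [|j js]; first by rewrite d_gt0.
  by rewrite -dE site_le_diam.
set m : R := (valid_count D G n)%:R in m_ge *.
have mt : 4 * q ^+ 2 * lam <= m * t ^+ 2.
  apply: le_trans (enough_windows t_gt0 t_le1 n_large m_ge).
  by rewrite -mulrA ler_pM2l// lerDl.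
have m_gt0 : 0 < m.
  rewrite (lt_le_trans _ m_ge)// LE -natrB// natr1 ltr0n//.
have B_gt0 : 0 < m * q ^+ 2 by rewrite mulr_gt0// exprn_gt0.
have n_gt0 : (0 < n)%N by rewrite (leq_trans d_gt0).
have g_max x (a : {ffun G -> A}) :
    count_with n b (point_indicator R a) x <=
    count_with n b (point_indicator R (g x)) x.
  have := fhat_estimator x b a.
  by rewrite ler_pM2r ?invr_gt0 ?ltr0n// !occurrencesE.
have qE : q = (size (sites D G))%:R / Gamma p by rewrite /q KE.
have [del_eps|eps_del] := leP del (eps / 2).
  have tE : t = eps / 2 by apply/max_idPl.
  rewrite tE in mt.
  apply: le_trans (mean_regime m_gt0 q_gt0 eps_gt0 lam_ge mt).
  rewrite qE in B_gt0 *.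
  exact: (regret_le_mean p_ge0 p_sum p_meas code_inj P_stationary p_cond Gamma_gt0
    uS a0S g_coords g_max).
have tE : t = del by apply/max_idPr; exact: ltW.
rewrite tE in mt.
have del_ge0 : 0 <= del by rewrite -tE ltW.
have [s s_ge0 s_eps] := tail_regime m_gt0 q_gt0 eps_gt0 beta_gt0 del_ge0 lam_ge mt.
apply: le_trans s_eps; rewrite qE in B_gt0 *.
apply: (regret_le_tail p_ge0 p_sum p_meas code_inj P_stationary p_cond Gamma_gt0
    uS a0S g_coords g_max) => // a.
exact: (margin_le_gap code_inj a0_max).
Qed.
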